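(* Let $T$ be a bounded linear operator on $\ell^2(\mathbb{Z})$ and let $K$ be a function defined on $\{(n,m)\in\mathbb{Z}\times\mathbb{Z}:\ |n|\neq|m|\}$ such that for every finitely supported $f=(f(n))_{n\in\mathbb{Z}}$, $$T(f)(n)=\sum_{m\in\mathbb{Z}}K(n,m)f(m)$$ for all $n\in\mathbb{Z}$ with $f(n)=f(-n)=0$. Assume there is a constant $C$ such that (i) $|K(n,m)|\le \dfrac{C}{|n-m|}$ for all $n,m$ with $|n|\ne|m|$; (ii) $|K(n,m)-K(n,\ell)|+|K(m,n)-K(\ell,n)|\le C\,\dfrac{|m-\ell|}{(|m|-|n|)^2}$ for all $m,n,\ell\in\mathbb{Z}$ such that $\big||m|-|n|\big|>2|m-\ell|$ and $\frac{|n|}{2}\le |m|,|\ell|\le\frac{3|n|}{2}$. Then for every $1<p<\infty$, $T$ extends to a bounded operator from $\ell^p(\mathbb{Z})$ to $\ell^p(\mathbb{Z})$. *)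

(* Defs.v *)
From Stdlib Require Import Reals ZArith.
From Coquelicot Require Import Coquelicot.
Open Scope R_scope.

(* x^p for x >= 0 and real p > 0, with the convention 0^p = 0
   (Stdlib's Rpower 0 p would be exp (p * ln 0) = 1). *)
Definition rpow (x p : R) : R :=
  match Rle_dec x 0 with left _ => 0 | right _ => Rpower x p end.

(* The nonnegative series sum_{n in Z} |f n|^p, enumerated as
   sum_{k >= 0} (|f k|^p + |f (-k-1)|^p). *)
Definition lp_terms (p : R) (f : Z -> C) (k : nat) : R :=
  rpow (Cmod (f (Z.of_nat k))) p + rpow (Cmod (f (- Z.of_nat k - 1)%Z)) p.

Definition in_lp (p : R) (f : Z -> C) : Prop := ex_series (lp_terms p f).

Definition lp_norm (p : R) (f : Z -> C) : R := rpow (Series (lp_terms p f)) (/ p).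

Definition supp_in (f : Z -> C) (N : nat) : Prop :=
  forall m : Z, (Z.of_nat N < Z.abs m)%Z -> f m = 0%C.

Definition zsum (g : Z -> C) (N : nat) : C :=
  sum_n (fun k : nat => g (Z.of_nat k - Z.of_nat N)%Z) (2 * N).

Definition lp_linear (p : R) (S : (Z -> C) -> (Z -> C)) : Prop :=
  (forall f g, in_lp p f -> in_lp p g ->
     forall n, S (fun k => Cplus (f k) (g k)) n = Cplus (S f n) (S g n)) /\
  (forall (c : C) f, in_lp p f ->
     forall n, S (fun k => Cmult c (f k)) n = Cmult c (S f n)).

Definition lp_bounded_op (p : R) (S : (Z -> C) -> (Z -> C)) : Prop :=
  lp_linear p S /\
  exists B : R, forall f, in_lp p f ->
     in_lp p (S f) /\ lp_norm p (S f) <= B * lp_norm p f.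

(* Main.v *)
Require Import Defs.
From Stdlib Require Import Reals ZArith Bool Lra Lia FunctionalExtensionality.
From Coquelicot Require Import Coquelicot.
Open Scope R_scope.

(* Fold Z onto N by n -> |n|: T becomes a family of real matrices (one for each choice of signs and
   of real or imaginary part) that are bounded on l^2 and have Calderon-Zygmund kernels, except that
   the smoothness is only local.  Keep the entries with 2x <= 3y and 2y <= 3x as local part.  It
   satisfies the Hormander condition (the cut along the boundary of this cone is harmless), hence is
   good on the atoms of a Calderon-Zygmund decomposition; the remaining entries are O(1/(x+1)), so
   the global part maps l^1 to weak l^1 by the size condition alone.  Since l^2 boundedness is only
   used for the whole matrix, this gives the weak type (1,1) estimate, then l^p for 1 < p < 2 by
   Marcinkiewicz interpolation over dyadic levels.  The hypotheses are stable under transposition,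
   so duality gives p > 2.  All these bounds are for finite sections, uniformly; the extension to
   l^p is the pointwise limit of T applied to truncations. *)

(** Nothing is known about the entries of T with |n| = |m|. Folding merges both diagonals into x =
    y, and the size bound survives opposite signs because then |n - m| = x + y. The merged diagonal
    is controlled only through the l^2 bound, which shapes the weak type estimate: the good part
    meets the whole matrix, only the bad part is split into local and global pieces, and near its
    atoms each output is merely counted as one point. The cone 2/3 <= x/y <= 3/2 is the largest one
    inside the window of (ii) that is invariant under transposition. Outside it |x - y| is at least
    a fixed fraction of x + 1, so the global part sends b to a sequence bounded by a multiple of
    |b|_1 / (x + 1), which exceeds t only at O(|b|_1 / t) points. Estimates are stated for p-th
    powers of norms: the triangle inequality becomes (x + y)^p <= 2^p (x^p + y^p), and in duality
    Young's inequality with absorption replaces Hölder's. Absorption is legitimate because every sum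
    is finite. *)

(** * Real powers that vanish at zero *)

Lemma rpow_Rpower (x p : R) : 0 < x -> rpow x p = Rpower x p.
Proof. intros Hx; unfold rpow; destruct (Rle_dec x 0); [lra | reflexivity]. Qed.

Lemma rpow_0 (p : R) : rpow 0 p = 0.
Proof. unfold rpow; destruct (Rle_dec 0 0); [reflexivity | lra]. Qed.

Lemma rpow_gt0 (x p : R) : 0 < x -> 0 < rpow x p.
Proof. intros Hx; rewrite rpow_Rpower by exact Hx; apply exp_pos. Qed.

Lemma rpow_ge0 (x p : R) : 0 <= rpow x p.
Proof.
unfold rpow; destruct (Rle_dec x 0); [lra | left; apply exp_pos].
Qed.

Lemma rpow_le (x y p : R) : 0 <= p -> x <= y -> rpow x p <= rpow y p.
Proof.
intros Hp Hxy; destruct (Rle_dec x 0) as [Hx|Hx].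
- replace (rpow x p) with 0 by (unfold rpow; destruct (Rle_dec x 0); tauto).
  apply rpow_ge0.
- rewrite !rpow_Rpower by lra; apply Rle_Rpower_l; lra.
Qed.

Lemma rpow_le_neg (x y p : R) : p <= 0 -> 0 < x -> x <= y -> rpow y p <= rpow x p.
Proof.
intros Hp Hx Hxy; rewrite !rpow_Rpower by lra.
replace p with (- (- p)) by ring; rewrite !(Rpower_Ropp _ (- p)).
apply Rinv_le_contravar; [apply exp_pos | apply Rle_Rpower_l; lra].
Qed.

Lemma rpow_mult (x y p : R) : 0 <= x -> 0 <= y -> rpow (x * y) p = rpow x p * rpow y p.
Proof.
intros [Hx| <-] [Hy| <-]; rewrite ?Rmult_0_l, ?Rmult_0_r, ?rpow_0, ?Rmult_0_l, ?Rmult_0_r;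
  try reflexivity.
rewrite !rpow_Rpower by (try apply Rmult_lt_0_compat; lra).
symmetry; apply Rpower_mult_distr; lra.
Qed.

Lemma rpow_rpow (x p q : R) : 0 <= x -> rpow (rpow x p) q = rpow x (p * q).
Proof.
intros [Hx| <-]; [|now rewrite !rpow_0].
rewrite (rpow_Rpower (rpow x p)), !rpow_Rpower by (try apply rpow_gt0; lra).
apply Rpower_mult.
Qed.

Lemma rpow_plus (x p q : R) : 0 <= x -> rpow x (p + q) = rpow x p * rpow x q.
Proof.
intros [Hx| <-]; [|rewrite !rpow_0; ring].
rewrite !rpow_Rpower by lra; apply Rpower_plus.
Qed.

Lemma rpow_1 (x : R) : 0 <= x -> rpow x 1 = x.
Proof.
intros [Hx| <-]; [|now rewrite rpow_0].
rewrite rpow_Rpower by lra; apply Rpower_1; lra.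
Qed.

Lemma rpow_2 (x : R) : 0 <= x -> rpow x 2 = x ^ 2.
Proof.
intros Hx; replace 2 with (1 + 1) by ring; rewrite rpow_plus, rpow_1 by exact Hx; ring.
Qed.

Lemma rpow_Rabs_2 (x : R) : rpow (Rabs x) 2 = x ^ 2.
Proof.
rewrite rpow_2, RPow_abs by apply Rabs_pos; apply Rabs_pos_eq, pow2_ge_0.
Qed.

Lemma rpow_inv (x p : R) : 0 < p -> 0 <= x -> rpow (rpow x p) (/ p) = x.
Proof.
intros Hp Hx; rewrite rpow_rpow by exact Hx.
replace (p * / p) with 1 by (field; lra); now apply rpow_1.
Qed.

Lemma rpow_inv_r (x p : R) : 0 < p -> 0 <= x -> rpow (rpow x (/ p)) p = x.
Proof.
intros Hp Hx; rewrite rpow_rpow by exact Hx.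
replace (/ p * p) with 1 by (field; lra); now apply rpow_1.
Qed.

Lemma rpow_gt1 (x p : R) : 1 < x -> 0 < p -> 1 < rpow x p.
Proof.
intros Hx Hp; rewrite rpow_Rpower by lra.
rewrite <- (Rpower_O x) by lra; apply Rpower_lt; lra.
Qed.

Lemma rpow_add_le (x y p : R) : 0 <= p -> 0 <= x -> 0 <= y ->
  rpow (x + y) p <= rpow 2 p * (rpow x p + rpow y p).
Proof.
intros Hp Hx Hy.
pose proof (rpow_ge0 x p); pose proof (rpow_ge0 y p); pose proof (rpow_ge0 2 p).
destruct (Rle_dec x y).
- apply Rle_trans with (rpow (2 * y) p); [apply rpow_le; lra|].
  rewrite rpow_mult by lra; nra.
- apply Rle_trans with (rpow (2 * x) p); [apply rpow_le; lra|].
  rewrite rpow_mult by lra; nra.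
Qed.

Lemma weak_young (p q eps x y : R) : 1 < p -> q = p / (p - 1) -> 0 < eps -> 0 <= x -> 0 <= y ->
  x * y <= rpow (/ eps) (q - 1) * rpow x q + eps * rpow y p.
Proof.
intros Hp Hq He Hx Hy.
assert (Hq1 : (p - 1) * (q - 1) = 1) by (subst q; field; lra).
assert (Hq0 : 0 < q - 1) by nra.
assert (0 <= rpow (/ eps) (q - 1) * rpow x q)
  by (apply Rmult_le_pos; apply rpow_ge0).
assert (0 <= eps * rpow y p) by (apply Rmult_le_pos; [lra | apply rpow_ge0]).
destruct (Rle_dec x (eps * rpow y (p - 1))) as [Hc|Hc].
- assert (Hy1 : rpow y p = rpow y (p - 1) * y).
  { replace p with ((p - 1) + 1) at 1 by ring; now rewrite rpow_plus, rpow_1. }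
  rewrite Hy1 in *; nra.
- assert (Hz : y <= rpow (/ eps * x) (q - 1)).
  { replace y with (rpow (rpow y (p - 1)) (q - 1)).
    - apply rpow_le; [lra|].
      apply (Rmult_le_reg_l eps); [lra|].
      replace (eps * (/ eps * x)) with x by (field; lra); lra.
    - rewrite rpow_rpow, Hq1 by exact Hy; now apply rpow_1. }
  rewrite rpow_mult in Hz by (try exact Hx; left; now apply Rinv_0_lt_compat).
  assert (Hx1 : rpow x q = rpow x (q - 1) * x).
  { replace q with ((q - 1) + 1) at 1 by ring; now rewrite rpow_plus, rpow_1. }
  rewrite Hx1 in *; nra.
Qed.

(** * Finite sums *)

Lemma sum_0 (f : nat -> R) : sum_f_R0 f 0 = f 0%nat.
Proof. reflexivity. Qed.

Lemma sum_ge0 (f : nat -> R) (N : nat) : (forall i, 0 <= f i) -> 0 <= sum_f_R0 f N.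
Proof. intros Hf; now apply cond_pos_sum. Qed.

Lemma sum_le (f g : nat -> R) (N : nat) :
  (forall i, (i <= N)%nat -> f i <= g i) -> sum_f_R0 f N <= sum_f_R0 g N.
Proof. intros H; now apply sum_Rle. Qed.

Lemma sum_scal (c : R) (f : nat -> R) (N : nat) :
  sum_f_R0 (fun i => c * f i) N = c * sum_f_R0 f N.
Proof. rewrite scal_sum; apply sum_eq; intros; ring. Qed.

Lemma sum_swap (f : nat -> nat -> R) (M N : nat) :
  sum_f_R0 (fun i => sum_f_R0 (f i) N) M = sum_f_R0 (fun j => sum_f_R0 (fun i => f i j) M) N.
Proof.
induction M as [|M IH]; simpl; [reflexivity|].
now rewrite IH, <- sum_plus.
Qed.

Lemma sum_mono (f : nat -> R) (M N : nat) :
  (forall i, 0 <= f i) -> (M <= N)%nat -> sum_f_R0 f M <= sum_f_R0 f N.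
Proof.
intros Hf; induction 1 as [|N HN IH]; simpl; [lra|]; specialize (Hf (S N)); lra.
Qed.

Lemma sum_single_le (f : nat -> R) (i N : nat) :
  (forall i, 0 <= f i) -> (i <= N)%nat -> f i <= sum_f_R0 f N.
Proof.
intros Hf Hi; apply Rle_trans with (sum_f_R0 f i); [|now apply sum_mono].
destruct i; simpl; [lra|]; pose proof (sum_ge0 f i Hf); lra.
Qed.

Lemma sum_const0 (f : nat -> R) (N : nat) : (forall i, (i <= N)%nat -> f i = 0) -> sum_f_R0 f N = 0.
Proof.
intros H; rewrite (sum_eq _ (fun _ => 0)) by exact H; rewrite sum_cte; ring.
Qed.

Definition trunc (N : nat) (f : nat -> R) (x : nat) : R := if (x <=? N)%nat then f x else 0.

Lemma sum_trunc (f : nat -> R) (M N : nat) :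
  (N <= M)%nat -> sum_f_R0 (trunc N f) M = sum_f_R0 f N.
Proof.
induction 1 as [|M HM IH].
- apply sum_eq; intros i Hi; unfold trunc; now apply Nat.leb_le in Hi as ->.
- simpl; rewrite IH; unfold trunc; destruct (Nat.leb_spec (S M) N); [lia | ring].
Qed.

Definition ind (b : bool) : R := if b then 1 else 0.

Lemma ind_ge0 (b : bool) : 0 <= ind b.
Proof. destruct b; simpl; lra. Qed.

Definition itv (c w x : nat) : bool := andb (c <=? x)%nat (x <? c + w)%nat.

Lemma itvP (c w x : nat) : reflect (c <= x < c + w)%nat (itv c w x).
Proof.
apply iff_reflect; unfold itv; rewrite andb_true_iff, Nat.leb_le, Nat.ltb_lt; reflexivity.
Qed.

Lemma sum_itv (c w N : nat) :
  sum_f_R0 (fun x => ind (itv c w x)) N = INR (Nat.min w (N + 1 - c)).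
Proof.
induction N as [|N IH]; simpl sum_f_R0; [|rewrite IH].
- destruct (itvP c w 0); simpl ind.
  + replace (Nat.min w (0 + 1 - c)) with 1%nat by lia; reflexivity.
  + replace (Nat.min w (0 + 1 - c)) with 0%nat by lia; reflexivity.
- destruct (itvP c w (S N)); simpl ind.
  + rewrite <- (S_INR _); f_equal; lia.
  + rewrite Rplus_0_r; f_equal; lia.
Qed.

Lemma sum_itv_le (c w N : nat) : sum_f_R0 (fun x => ind (itv c w x)) N <= INR w.
Proof. rewrite sum_itv; apply le_INR; lia. Qed.

Lemma sum_inv_sq_right (c D N : nat) : (1 <= D)%nat ->
  sum_f_R0 (fun x => ind (c + D <=? x)%nat / (INR x - INR c) ^ 2) N <= 2 / INR D.
Proof.
intros HD.
(* Telescoping with 1/d^2 <= 2/d - 2/(d+1) for d >= 1. The maximum with [D] keeps the bound at 0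
   until the index reaches [c + D]. *)
cut (sum_f_R0 (fun x => ind (c + D <=? x)%nat / (INR x - INR c) ^ 2) N
     <= 2 / INR D - 2 / INR (Nat.max (N + 1 - c) D)).
{ intros H; enough (0 < 2 / INR (Nat.max (N + 1 - c) D)) by lra.
  apply Rdiv_lt_0_compat; [lra | apply lt_0_INR; lia]. }
induction N as [|N IH]; [rewrite sum_0 | rewrite tech5].
- destruct (Nat.leb_spec (c + D) 0); [lia|].
  replace (Nat.max (0 + 1 - c) D) with D by lia; simpl ind; lra.
- destruct (Nat.leb_spec (c + D) (S N)).
  + replace (Nat.max (N + 1 - c) D) with (S N - c)%nat in IH by lia.
    replace (Nat.max (S N + 1 - c) D) with (S (S N - c))%nat by lia.
    rewrite <- minus_INR by lia.
    assert (Hd : 1 <= INR (S N - c)) by (apply (le_INR 1); lia).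
    rewrite (S_INR (S N - c)).
    set (d := INR (S N - c)) in *; simpl ind.
    enough (1 / d ^ 2 <= 2 / d - 2 / (d + 1)) by lra.
    apply (Rmult_le_reg_r (d ^ 2 * (d + 1))); [nra|].
    replace (1 / d ^ 2 * (d ^ 2 * (d + 1))) with (d + 1) by (field; lra).
    replace ((2 / d - 2 / (d + 1)) * (d ^ 2 * (d + 1))) with (2 * d) by (field; lra).
    lra.
  + replace (Nat.max (N + 1 - c) D) with D in IH by lia.
    replace (Nat.max (S N + 1 - c) D) with D by lia.
    simpl ind; lra.
Qed.

Lemma sum_inv_sq_left (c D N : nat) : (1 <= D)%nat ->
  sum_f_R0 (fun x => ind (x + D <=? c)%nat / (INR x - INR c) ^ 2) N <= 2 / INR D.
Proof.
intros HD.
assert (Hmax : forall u v : nat, (1 <= u)%nat -> (u <= v)%nat -> 2 / INR v <= 2 / INR u).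
{ intros u v Hu Huv; apply Rmult_le_compat_l; [lra|].
  apply Rinv_le_contravar; [apply lt_0_INR; lia | now apply le_INR]. }
(* The same telescoping, now run towards [c]: the distance shrinks as the sum grows, so the latest
   distance governs the partial sum. *)
cut (sum_f_R0 (fun x => ind (x + D <=? c)%nat / (INR x - INR c) ^ 2) N
     <= 2 / INR (Nat.max (c - N) D)).
{ intros H; eapply Rle_trans; [apply H | apply Hmax; lia]. }
induction N as [|N IH]; [rewrite sum_0 | rewrite tech5].
- destruct (Nat.leb_spec (0 + D) c); simpl ind.
  + replace (Nat.max (c - 0) D) with c by lia.
    assert (Hd : 1 <= INR c) by (apply (le_INR 1); lia).
    change (INR 0) with 0; apply (Rmult_le_reg_r (INR c ^ 2)); [nra|].
    replace (0 - INR c) with (- INR c) by ring.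
    replace (1 / (- INR c) ^ 2 * INR c ^ 2) with 1 by (field; lra).
    replace (2 / INR c * INR c ^ 2) with (2 * INR c) by (field; lra); lra.
  + replace (0 / (INR 0 - INR c) ^ 2) with 0 by (unfold Rdiv; ring).
    left; apply Rdiv_lt_0_compat; [lra | apply lt_0_INR; lia].
- destruct (Nat.leb_spec (S N + D) c).
  + replace (Nat.max (c - N) D) with (S (c - S N))%nat in IH by lia.
    replace (Nat.max (c - S N) D) with (c - S N)%nat by lia.
    replace (INR (S N) - INR c) with (- INR (c - S N)) by (rewrite minus_INR by lia; ring).
    assert (Hd : 1 <= INR (c - S N)) by (apply (le_INR 1); lia).
    rewrite (S_INR (c - S N)) in IH.
    set (d := INR (c - S N)) in *; simpl ind.
    enough (1 / (- d) ^ 2 <= 2 / d - 2 / (d + 1)) by lra.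
    apply (Rmult_le_reg_r (d ^ 2 * (d + 1))); [nra|].
    replace (1 / (- d) ^ 2 * (d ^ 2 * (d + 1))) with (d + 1) by (field; lra).
    replace ((2 / d - 2 / (d + 1)) * (d ^ 2 * (d + 1))) with (2 * d) by (field; lra).
    lra.
  + simpl ind; unfold Rdiv at 2; rewrite Rmult_0_l, Rplus_0_r.
    eapply Rle_trans; [apply IH | apply Hmax; lia].
Qed.

(** The condition is closed downwards in [x]: if [N] satisfies it, the trivial count [N + 1] is at
    most [M / t]; if not, the last term is 0. This is the weak l^1 bound for the sequence
    1/(x+1). *)
Lemma sum_count_lt (t M : R) (N : nat) : 0 < t -> 0 <= M ->
  sum_f_R0 (fun x => if Rlt_dec (t * (INR x + 1)) M then 1 else 0) N <= M / t.
Proof.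
intros Ht HM.
assert (Hcnt : forall N, sum_f_R0 (fun x => if Rlt_dec (t * (INR x + 1)) M then 1 else 0) N
                 <= INR N + 1).
{ intros K; induction K as [|K IH]; [simpl sum_f_R0 | rewrite tech5].
  - destruct (Rlt_dec _ _); simpl; lra.
  - rewrite S_INR; destruct (Rlt_dec _ _); lra. }
assert (Hlast : forall N, t * (INR N + 1) < M -> INR N + 1 <= M / t).
{ intros K HK; apply (Rmult_le_reg_r t); [lra|].
  unfold Rdiv; rewrite Rmult_assoc, Rinv_l by lra; lra. }
induction N as [|N IH].
- simpl; destruct (Rlt_dec _ _) as [H|H].
  + specialize (Hlast 0%nat); simpl in Hlast; lra.
  + apply Rdiv_le_0_compat; lra.
- specialize (Hcnt (S N)); specialize (Hlast (S N)); rewrite tech5 in *.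
  destruct (Rlt_dec _ _) as [H|H]; [|lra].
  specialize (Hlast H); lra.
Qed.

(** * Matrices and their finite sections *)

Definition mapply (a : nat -> nat -> R) (N : nat) (f : nat -> R) (x : nat) : R :=
  sum_f_R0 (fun y => a x y * f y) N.

(** [B] plays the role of the p-th power of an operator norm, uniform over all finite sections. *)
Definition lp_bound (p : R) (a : nat -> nat -> R) (B : R) : Prop :=
  forall N f, sum_f_R0 (fun x => rpow (Rabs (mapply a N f x)) p) N
              <= B * sum_f_R0 (fun y => rpow (Rabs (f y)) p) N.

Definition transpose (a : nat -> nat -> R) (x y : nat) : R := a y x.

Lemma mapply_plus a N f g x :
  mapply a N (fun y => f y + g y) x = mapply a N f x + mapply a N g x.
Proof. unfold mapply; rewrite <- sum_plus; apply sum_eq; intros; ring. Qed.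

Lemma mapply_transpose a N f g :
  sum_f_R0 (fun x => g x * mapply a N f x) N
  = sum_f_R0 (fun y => mapply (transpose a) N g y * f y) N.
Proof.
transitivity (sum_f_R0 (fun x => sum_f_R0 (fun y => g x * (a x y * f y)) N) N).
- apply sum_eq; intros; unfold mapply; now rewrite sum_scal.
- rewrite sum_swap; apply sum_eq; intros y _; unfold mapply, transpose.
  rewrite (Rmult_comm _ (f y)), <- sum_scal; apply sum_eq; intros; ring.
Qed.

(** Test against the dual function [w] = sign(h) |h|^(q-1), whose p-th power sum is again [X], since
    (q - 1) p = q. The pairing of [g] with the image of [w] equals [X]; Young's inequality with
    [eps * B <= 1/2] bounds it by a multiple of the q-sum of [g] plus X/2, and X/2 is absorbed. *)
Lemma lp_bound_transpose (p q B : R) (a : nat -> nat -> R) :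
  1 < p -> q = p / (p - 1) -> 0 <= B -> lp_bound p a B ->
  exists B', 0 <= B' /\ lp_bound q (transpose a) B'.
Proof.
intros Hp Hq HB Ha.
assert (Hq1 : (p - 1) * (q - 1) = 1) by (subst q; field; lra).
set (eps := / (2 * (B + 1))).
assert (He : 0 < eps) by (apply Rinv_0_lt_compat; lra).
assert (HeB : eps * B <= / 2).
{ unfold eps; apply (Rmult_le_reg_r (2 * (B + 1))); [lra|].
  replace (/ (2 * (B + 1)) * B * (2 * (B + 1))) with B by (field; lra); lra. }
set (M := rpow (/ eps) (q - 1)).
assert (HM : 0 <= M) by apply rpow_ge0.
exists (2 * M); split; [lra|]; intros N g.
set (h := mapply (transpose a) N g).
set (X := sum_f_R0 (fun x => rpow (Rabs (h x)) q) N).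
set (w := fun y => (if Rle_dec 0 (h y) then 1 else -1) * rpow (Rabs (h y)) (q - 1)).
assert (HX0 : 0 <= X) by (apply sum_ge0; intros; apply rpow_ge0).
assert (HX : X = sum_f_R0 (fun x => g x * mapply a N w x) N).
{ rewrite mapply_transpose; apply sum_eq; intros y _; fold h; unfold w.
  replace q with (1 + (q - 1)) at 1 by ring.
  rewrite rpow_plus, rpow_1 by apply Rabs_pos.
  destruct (Rle_dec 0 (h y)); [rewrite (Rabs_pos_eq (h y)) by lra | rewrite (Rabs_left (h y)) by lra]; ring. }
assert (Hw : sum_f_R0 (fun y => rpow (Rabs (w y)) p) N = X).
{ apply sum_eq; intros y _; unfold w.
  rewrite Rabs_mult, (Rabs_pos_eq (rpow _ _)) by apply rpow_ge0.
  replace (Rabs (if Rle_dec 0 (h y) then 1 else -1)) with 1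
    by (destruct (Rle_dec 0 (h y)); [rewrite Rabs_pos_eq | rewrite Rabs_left]; lra).
  rewrite Rmult_1_l, rpow_rpow by apply Rabs_pos; f_equal; nra. }
specialize (Ha N w); rewrite Hw in Ha.
enough (HXle : X <= M * sum_f_R0 (fun y => rpow (Rabs (g y)) q) N
         + eps * sum_f_R0 (fun x => rpow (Rabs (mapply a N w x)) p) N) by nra.
rewrite <- !sum_scal, <- sum_plus; rewrite HX at 1; apply sum_le; intros x _.
eapply Rle_trans; [apply Rle_abs|]; rewrite Rabs_mult.
apply weak_young; auto using Rabs_pos.
Qed.

(** * Calderon-Zygmund decomposition *)

(* Instead of recording the family of stopping intervals, the induction carries the value of a
   subadditive functional [Phi] on the bad part; it suffices to control [Phi] on atoms. *)
Lemma cz_decomposition (Phi : (nat -> R) -> R) (N : nat) (lam C : R) :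
  0 < lam -> 0 <= C ->
  Phi (fun _ => 0) <= 0 ->
  (forall b1 b2, Phi (fun x => b1 x + b2 x) <= Phi b1 + Phi b2) ->
  (forall c s b, (0 < s)%nat -> (c + s <= N + 1)%nat ->
     (forall x, itv c s x = false -> b x = 0) -> sum_f_R0 b N = 0 ->
     Phi b <= C * INR s + C * sum_f_R0 (fun x => Rabs (b x)) N / lam) ->
  forall k c f, (c + 2 ^ k <= N + 1)%nat ->
  (forall x, itv c (2 ^ k) x = false -> f x = 0) ->
  sum_f_R0 (fun x => Rabs (f x)) N <= lam * INR (2 ^ k) ->
  exists g,
    (forall x, itv c (2 ^ k) x = false -> g x = 0) /\
    (forall x, Rabs (g x) <= 2 * lam) /\
    sum_f_R0 (fun x => Rabs (g x)) N <= sum_f_R0 (fun x => Rabs (f x)) N /\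
    Phi (fun x => f x - g x) <= 3 * C * sum_f_R0 (fun x => Rabs (f x)) N / lam.
Proof.
intros Hlam HC HPhi0 HPhiD Hatom k.
induction k as [|k IH]; intros c f Hc Hf Havg.
- exists f; repeat split; auto; [intros x | lra |].
  + destruct (itv c (2 ^ 0) x) eqn:Hx.
    * assert (Hx' := sum_single_le (fun x => Rabs (f x)) x N (fun _ => Rabs_pos _)).
      destruct (itvP c (2 ^ 0) x) as [H|]; [|discriminate].
      simpl in *; specialize (Hx' ltac:(lia)); lra.
    * rewrite Hf, Rabs_R0 by exact Hx; lra.
  + replace (fun x => f x - f x) with (fun _ : nat => 0)
      by (apply functional_extensionality; intros; ring).
    apply Rle_trans with 0; [exact HPhi0|].
    apply Rdiv_le_0_compat; [|exact Hlam].
    apply Rmult_le_pos; [lra | apply sum_ge0; intros; apply Rabs_pos].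
- set (s := (2 ^ k)%nat) in *.
  assert (Hs : (0 < s)%nat) by (apply Nat.neq_0_lt_0, Nat.pow_nonzero; lia).
  assert (HsR : 0 < INR s) by now apply lt_0_INR.
  assert (H2s : (2 ^ S k = s + s)%nat) by (simpl; fold s; lia).
  rewrite H2s in *.
  (* One child of a dyadic interval. Its average is at most [2 * lam] because the parent's is at
     most [lam]. If it is still at most [lam] the recursion continues; otherwise the child is a
     stopping interval and [g] is the mean there. *)
  assert (Hhalf : forall c' f', (c' + s <= N + 1)%nat ->
    (forall x, itv c' s x = false -> f' x = 0) ->
    sum_f_R0 (fun x => Rabs (f' x)) N <= 2 * lam * INR s ->
    exists g,
      (forall x, itv c' s x = false -> g x = 0) /\
      (forall x, Rabs (g x) <= 2 * lam) /\
      sum_f_R0 (fun x => Rabs (g x)) N <= sum_f_R0 (fun x => Rabs (f' x)) N /\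
      Phi (fun x => f' x - g x) <= 3 * C * sum_f_R0 (fun x => Rabs (f' x)) N / lam).
  { intros c' f' Hc' Hf' Hle.
    set (F := sum_f_R0 (fun x => Rabs (f' x)) N) in *.
    destruct (Rle_dec F (lam * INR s)) as [Hsmall|Hbig]; [now apply IH|].
    set (m := sum_f_R0 f' N / INR s).
    assert (Hm : Rabs m * INR s <= F).
    { unfold m; rewrite <- (Rabs_pos_eq (INR s)) at 2 by lra.
      rewrite <- Rabs_mult; unfold Rdiv; rewrite Rmult_assoc, Rinv_l, Rmult_1_r by lra.
      apply Rsum_abs. }
    assert (Hcount : sum_f_R0 (fun x => ind (itv c' s x)) N = INR s)
      by (rewrite sum_itv; f_equal; lia).
    assert (HG : sum_f_R0 (fun x => Rabs (m * ind (itv c' s x))) N = Rabs m * INR s).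
    { rewrite <- Hcount, <- sum_scal; apply sum_eq; intros.
      now rewrite Rabs_mult, (Rabs_pos_eq (ind _)) by apply ind_ge0. }
    exists (fun x => m * ind (itv c' s x)); repeat split.
    - intros x ->; simpl; ring.
    - intros x; rewrite Rabs_mult, (Rabs_pos_eq (ind _)) by apply ind_ge0.
      assert (Rabs m <= 2 * lam) by (apply (Rmult_le_reg_r (INR s)); lra).
      pose proof (Rabs_pos m); destruct (itv c' s x); simpl; lra.
    - rewrite HG; exact Hm.
    (* The constant 3: stopping means [INR s < F / lam], and subtracting the mean at most doubles
       the l^1 norm, so the atom costs at most [C + 2 * C] times [F / lam]. *)
    - eapply Rle_trans; [apply (Hatom c' s)|]; trivial.
      + intros x Hx; rewrite Hf', Hx by exact Hx; simpl; ring.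
      + rewrite minus_sum, sum_scal, Hcount; unfold m; field; lra.
      + assert (Hb : sum_f_R0 (fun x => Rabs (f' x - m * ind (itv c' s x))) N <= 2 * F).
        { apply Rle_trans with (F + Rabs m * INR s); [|lra].
          rewrite <- HG; unfold F; rewrite <- sum_plus; apply sum_le; intros.
          unfold Rminus; rewrite <- (Rabs_Ropp (m * _)); apply Rabs_triang. }
        apply (Rmult_le_reg_r lam); [exact Hlam|].
        unfold Rdiv; rewrite Rmult_plus_distr_r, !(Rmult_assoc _ (/ lam)), Rinv_l, !Rmult_1_r by lra.
        nra. }
  set (f1 := fun x => if itv c s x then f x else 0).
  set (f2 := fun x => if itv (c + s) s x then f x else 0).
  assert (Hf12 : forall x, f x = f1 x + f2 x /\ Rabs (f x) = Rabs (f1 x) + Rabs (f2 x)).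
  { intros x; unfold f1, f2; pose proof (Hf x).
    destruct (itvP c (s + s) x), (itvP c s x), (itvP (c + s) s x); try lia;
      rewrite ?H by reflexivity; rewrite ?Rabs_R0; lra. }
  assert (HF : sum_f_R0 (fun x => Rabs (f x)) N
     = sum_f_R0 (fun x => Rabs (f1 x)) N + sum_f_R0 (fun x => Rabs (f2 x)) N).
  { rewrite <- sum_plus; apply sum_eq; intros; apply Hf12. }
  assert (0 <= sum_f_R0 (fun x => Rabs (f1 x)) N) by (apply sum_ge0; intros; apply Rabs_pos).
  assert (0 <= sum_f_R0 (fun x => Rabs (f2 x)) N) by (apply sum_ge0; intros; apply Rabs_pos).
  rewrite plus_INR in Havg.
  destruct (Hhalf c f1) as (g1 & Hg1s & Hg1b & Hg1n & Hg1P);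
    [lia | intros x Hx; unfold f1; now rewrite Hx | lra |].
  destruct (Hhalf (c + s)%nat f2) as (g2 & Hg2s & Hg2b & Hg2n & Hg2P);
    [lia | intros x Hx; unfold f2; now rewrite Hx | lra |].
  exists (fun x => g1 x + g2 x); repeat split.
  + intros x Hx; rewrite Hg1s, Hg2s; [ring | |];
      destruct (itvP c (s + s) x); try discriminate.
    * destruct (itvP (c + s) s x); [lia | reflexivity].
    * destruct (itvP c s x); [lia | reflexivity].
  + intros x; destruct (itvP c s x) as [Hx|Hx].
    * rewrite Hg2s, Rplus_0_r by (destruct (itvP (c + s) s x); [lia | reflexivity]); apply Hg1b.
    * rewrite Hg1s, Rplus_0_l by (destruct (itvP c s x); [lia | reflexivity]); apply Hg2b.
  + apply Rle_trans with (sum_f_R0 (fun x => Rabs (g1 x)) N + sum_f_R0 (fun x => Rabs (g2 x)) N).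
    * rewrite <- sum_plus; apply sum_le; intros; apply Rabs_triang.
    * lra.
  + replace (fun x => f x - (g1 x + g2 x)) with (fun x => (f1 x - g1 x) + (f2 x - g2 x))
      by (apply functional_extensionality; intros x; rewrite (proj1 (Hf12 x)); ring).
    eapply Rle_trans; [apply HPhiD|]; rewrite HF.
    unfold Rdiv in *; nra.
Qed.

(** * The weak type estimate *)

(** The smoothness window [1/2, 3/2] with its lower edge raised to 2/3, which makes the relation
    symmetric. *)
Definition comparable (x y : nat) : bool := andb (2 * x <=? 3 * y)%nat (2 * y <=? 3 * x)%nat.

Lemma comparableP (x y : nat) :
  reflect (2 * x <= 3 * y /\ 2 * y <= 3 * x)%nat (comparable x y).
Proof.
apply iff_reflect; unfold comparable; rewrite andb_true_iff, !Nat.leb_le; reflexivity.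
Qed.

Definition size_bound (a : nat -> nat -> R) (C : R) : Prop :=
  forall x y, x <> y -> Rabs (a x y) <= C / Rabs (INR x - INR y).

Definition smooth_bound (a : nat -> nat -> R) (C : R) : Prop :=
  forall x c y, 2 * Rabs (INR c - INR y) < Rabs (INR c - INR x) ->
    comparable x c = true -> comparable x y = true ->
    Rabs (a x c - a x y) <= C * Rabs (INR c - INR y) / (INR c - INR x) ^ 2.

Definition local_part (a : nat -> nat -> R) (x y : nat) : R :=
  if comparable x y then a x y else 0.

Definition global_part (a : nat -> nat -> R) (x y : nat) : R :=
  if comparable x y then 0 else a x y.

(** Off the cone, [2 * x > 3 * y] or [2 * y > 3 * x]; in either case |x - y| is at least (x + 1)/6,
    so the size bound depends on the row only. *)
Lemma global_part_bound a C x y : 0 <= C -> size_bound a C ->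
  Rabs (global_part a x y) <= 6 * C / (INR x + 1).
Proof.
intros HC Ha; unfold global_part.
assert (Hx : 0 <= INR x) by apply pos_INR.
destruct (comparableP x y) as [H|H].
- rewrite Rabs_R0; apply Rdiv_le_0_compat; lra.
- assert (Hd : INR x + 1 <= 6 * Rabs (INR x - INR y)).
  { rewrite <- S_INR; destruct (Nat.le_gt_cases y x) as [Hxy|Hxy].
    + rewrite <- minus_INR, Rabs_pos_eq by (try apply pos_INR; lia).
      replace 6 with (INR 6) by (simpl; ring); rewrite <- mult_INR; apply le_INR; lia.
    + rewrite Rabs_minus_sym, <- minus_INR, Rabs_pos_eq by (try apply pos_INR; lia).
      replace 6 with (INR 6) by (simpl; ring); rewrite <- mult_INR; apply le_INR; lia. }
  eapply Rle_trans; [apply Ha; intros ->; lia|].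
  apply (Rmult_le_reg_r (Rabs (INR x - INR y))); [lra|].
  unfold Rdiv at 1; rewrite Rmult_assoc, Rinv_l by lra.
  apply (Rmult_le_reg_r (INR x + 1)); [lra|].
  replace (6 * C / (INR x + 1) * Rabs (INR x - INR y) * (INR x + 1))
    with (C * (6 * Rabs (INR x - INR y))) by (field; lra).
  nra.
Qed.

Definition far (c s x : nat) : bool := orb (c + 4 * s <=? x)%nat (x + 4 * s <=? c)%nat.

(* Where exactly one of [(x, y)], [(x, c)] is comparable, [x] lies in one of two intervals of
   length O(s), on each of which the size bound C / (3 s) suffices. *)
Lemma local_part_hormander a C c s y N :
  0 <= C -> size_bound a C -> smooth_bound a C -> (0 < s)%nat -> itv c s y = true ->
  sum_f_R0 (fun x => ind (far c s x) * Rabs (local_part a x y - local_part a x c)) N <= 3 * C.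
Proof.
intros HC Hsz Hsm Hs Hy; destruct (itvP c s y) as [Hcy|]; [clear Hy|discriminate].
assert (HsR : 0 < INR s) by now apply lt_0_INR.
assert (HcR : INR c <= INR y) by (apply le_INR; lia).
assert (HyR : INR y < INR c + INR s) by (rewrite <- plus_INR; apply lt_INR; lia).
set (D := (4 * s)%nat).
assert (HDR : INR D = 4 * INR s) by (unfold D; rewrite mult_INR; simpl; ring).
assert (Hone : forall x z, comparable x z = true -> 3 * INR s <= Rabs (INR x - INR z) ->
                 Rabs (local_part a x z) <= C / (3 * INR s)).
{ intros x z Hxz Hd; unfold local_part; rewrite Hxz.
  eapply Rle_trans; [apply Hsz|].
  - intros ->; rewrite Rminus_diag, Rabs_R0 in Hd; lra.
  - apply Rmult_le_compat_l; [exact HC | apply Rinv_le_contravar; lra]. }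
assert (Hpt : forall x, ind (far c s x) * Rabs (local_part a x y - local_part a x c)
  <= C * INR s * (ind (c + D <=? x)%nat / (INR x - INR c) ^ 2
                  + ind (x + D <=? c)%nat / (INR x - INR c) ^ 2)
     + C / (3 * INR s) * (ind (itv (3 * c / 2) (2 * s) x) + ind (itv (2 * c / 3) (2 * s) x))).
{ intros x.
  assert (Hsq : forall b, 0 <= ind b / (INR x - INR c) ^ 2).
  { intros b; apply Rmult_le_pos; [apply ind_ge0|].
    destruct (Req_dec (INR x - INR c) 0) as [->|Hne];
      [rewrite pow_i, Rinv_0 by lia; lra | left; apply Rinv_0_lt_compat; nra]. }
  assert (HA : 0 <= C * INR s * (ind (c + D <=? x)%nat / (INR x - INR c) ^ 2
                  + ind (x + D <=? c)%nat / (INR x - INR c) ^ 2)).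
  { apply Rmult_le_pos; [nra|]; pose proof (Hsq (c + D <=? x)%nat);
    pose proof (Hsq (x + D <=? c)%nat); lra. }
  assert (HCs : 0 <= C / (3 * INR s)) by (apply Rdiv_le_0_compat; lra).
  assert (HB : 0 <= C / (3 * INR s) *
     (ind (itv (3 * c / 2) (2 * s) x) + ind (itv (2 * c / 3) (2 * s) x))).
  { apply Rmult_le_pos; [lra|].
    pose proof (ind_ge0 (itv (3 * c / 2) (2 * s) x));
    pose proof (ind_ge0 (itv (2 * c / 3) (2 * s) x)); lra. }
  destruct (far c s x) eqn:Hfar;
    [change (ind true) with 1; rewrite Rmult_1_l | change (ind false) with 0; lra].
  unfold far in Hfar; apply orb_true_iff in Hfar; rewrite !Nat.leb_le in Hfar; fold D in Hfar.
  assert (Hd : INR D <= Rabs (INR x - INR c)).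
  { destruct Hfar as [H|H].
    - apply le_INR in H; rewrite plus_INR in H; rewrite Rabs_pos_eq; lra.
    - apply le_INR in H; rewrite plus_INR in H; rewrite Rabs_left; lra. }
  assert (Hd' : 3 * INR s <= Rabs (INR x - INR y)).
  { destruct Hfar as [H|H].
    - apply le_INR in H; rewrite plus_INR in H; rewrite Rabs_pos_eq; lra.
    - apply le_INR in H; rewrite plus_INR in H; rewrite Rabs_left; lra. }
  destruct (comparable x y) eqn:Hxy, (comparable x c) eqn:Hxc.
  - assert (Hl : Rabs (local_part a x y - local_part a x c)
              <= C * Rabs (INR c - INR y) / (INR c - INR x) ^ 2).
    { unfold local_part; rewrite Hxy, Hxc, Rabs_minus_sym; apply Hsm; trivial.
      rewrite (Rabs_minus_sym (INR c) (INR x)), (Rabs_minus_sym (INR c) (INR y)),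
        (Rabs_pos_eq (INR y - INR c)) by lra; lra. }
    rewrite (Rabs_minus_sym (INR c)), (Rabs_pos_eq (INR y - INR c)) in Hl by lra.
    assert (Hne : 0 < (INR x - INR c) ^ 2).
    { apply pow2_gt_0; intros E; rewrite E, Rabs_R0 in Hd; lra. }
    replace ((INR c - INR x) ^ 2) with ((INR x - INR c) ^ 2) in Hl by ring.
    assert (Hinv := Rinv_0_lt_compat _ Hne).
    assert (C * INR s * / (INR x - INR c) ^ 2 <=
       C * INR s * (ind (c + D <=? x)%nat / (INR x - INR c) ^ 2
                  + ind (x + D <=? c)%nat / (INR x - INR c) ^ 2)).
    { apply Rmult_le_compat_l; [nra|].
      pose proof (Hsq (c + D <=? x)%nat); pose proof (Hsq (x + D <=? c)%nat).
      destruct Hfar as [H1|H1]; apply Nat.leb_le in H1; rewrite H1 in *; change (ind true) with 1 in *;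
        unfold Rdiv in *; lra. }
    assert (C * (INR y - INR c) * / (INR x - INR c) ^ 2 <= C * INR s * / (INR x - INR c) ^ 2)
      by (apply Rmult_le_compat_r; nra).
    unfold Rdiv in *; lra.
  (* As [c <= y], only the upper edge of the cone can exclude [c]: 3c < 2x <= 3y < 3(c + s). In the
     next case only the lower edge can exclude [y]: 2c <= 3x < 2y < 2(c + s). Both windows have
     length at most 2s, even after rounding. *)
  - assert (Hl := Hone x y Hxy Hd').
    unfold local_part at 2; rewrite Hxc, Rminus_0_r.
    destruct (itvP (3 * c / 2) (2 * s) x) as [_|Hn].
    + change (ind true) with 1; pose proof (ind_ge0 (itv (2 * c / 3) (2 * s) x)); nra.
    + exfalso; apply Hn.
      destruct (comparableP x y); [|discriminate]; destruct (comparableP x c); [discriminate|].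
      pose proof (Nat.div_mod_eq (3 * c) 2); pose proof (Nat.mod_upper_bound (3 * c) 2); lia.
  - assert (Hl := Hone x c Hxc ltac:(lra)).
    unfold local_part at 1; rewrite Hxy, Rminus_0_l, Rabs_Ropp.
    destruct (itvP (2 * c / 3) (2 * s) x) as [_|Hn].
    + change (ind true) with 1; pose proof (ind_ge0 (itv (3 * c / 2) (2 * s) x)); nra.
    + exfalso; apply Hn.
      destruct (comparableP x y); [discriminate|]; destruct (comparableP x c); [|discriminate].
      pose proof (Nat.div_mod_eq (2 * c) 3); pose proof (Nat.mod_upper_bound (2 * c) 3); lia.
  - unfold local_part; rewrite Hxy, Hxc, Rminus_0_r, Rabs_R0; lra. }
eapply Rle_trans; [apply sum_le; intros x _; apply Hpt|].
rewrite sum_plus, !sum_scal, !sum_plus.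
assert (H1 := sum_inv_sq_right c D N ltac:(lia)).
assert (H2 := sum_inv_sq_left c D N ltac:(lia)).
assert (H3 := sum_itv_le (3 * c / 2) (2 * s) N).
assert (H4 := sum_itv_le (2 * c / 3) (2 * s) N).
rewrite mult_INR in H3, H4; simpl (INR 2) in H3, H4; rewrite HDR in H1, H2.
(* The two tails contribute C, the two edge windows 4C/3, and 7/3 is rounded up to 3. *)
apply Rle_trans with (C * INR s * (2 / (4 * INR s) + 2 / (4 * INR s))
   + C / (3 * INR s) * ((1 + 1) * INR s + (1 + 1) * INR s)).
- apply Rplus_le_compat; apply Rmult_le_compat_l; try nra.
  apply Rdiv_le_0_compat; lra.
- replace (C * INR s * (2 / (4 * INR s) + 2 / (4 * INR s))
   + C / (3 * INR s) * ((1 + 1) * INR s + (1 + 1) * INR s)) with (C + 4 / 3 * C) by (field; lra).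
  lra.
Qed.

Lemma Rmin_1_subadd (lam u v : R) : 0 < lam ->
  Rmin 1 (Rabs (u + v) / lam) <= Rmin 1 (Rabs u / lam) + Rmin 1 (Rabs v / lam).
Proof.
intros Hlam; pose proof (Rabs_triang u v) as Ht.
assert (H : Rabs (u + v) / lam <= Rabs u / lam + Rabs v / lam).
{ unfold Rdiv; rewrite <- Rmult_plus_distr_r; apply Rmult_le_compat_r; [|exact Ht].
  left; now apply Rinv_0_lt_compat. }
assert (0 <= Rabs u / lam) by (apply Rdiv_le_0_compat; auto using Rabs_pos).
assert (0 <= Rabs v / lam) by (apply Rdiv_le_0_compat; auto using Rabs_pos).
unfold Rmin; repeat destruct Rle_dec; lra.
Qed.

(** A subadditive substitute for the number of points where the image exceeds [lam], which is not
    subadditive itself. It serves as [Phi] in the decomposition. *)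
Definition capped_sum (a : nat -> nat -> R) (N : nat) (lam : R) (b : nat -> R) : R :=
  sum_f_R0 (fun x => Rmin 1 (Rabs (mapply a N b x) / lam)) N.

(** Within distance 4s of [c] each point costs at most 1, whatever the matrix does there. Farther
    away the vanishing sum of [b] allows subtracting the column at [c], and the Hormander bound
    gives 3C |b|_1 / lam. *)
Lemma capped_sum_atom a C N lam c s b :
  0 <= C -> size_bound a C -> smooth_bound a C -> 0 < lam -> (0 < s)%nat -> (c + s <= N + 1)%nat ->
  (forall x, itv c s x = false -> b x = 0) -> sum_f_R0 b N = 0 ->
  capped_sum (local_part a) N lam b
  <= (8 + 3 * C) * INR s + (8 + 3 * C) * sum_f_R0 (fun x => Rabs (b x)) N / lam.
Proof.
intros HC Hsz Hsm Hlam Hs HcN Hb Hb0; unfold capped_sum.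
set (al := local_part a).
assert (HF : 0 <= sum_f_R0 (fun x => Rabs (b x)) N) by (apply sum_ge0; intros; apply Rabs_pos).
(* If [c < 4 * s] the truncated subtraction starts the interval at 0; its length 8s still covers
   every point that is not far. *)
assert (Hpt : forall x, Rmin 1 (Rabs (mapply al N b x) / lam) <=
  ind (itv (c - 4 * s) (8 * s) x)
  + / lam * sum_f_R0 (fun y => Rabs (b y) * (ind (far c s x) * Rabs (al x y - al x c))) N).
{ intros x.
  assert (Hge : 0 <= / lam *
     sum_f_R0 (fun y => Rabs (b y) * (ind (far c s x) * Rabs (al x y - al x c))) N).
  { apply Rmult_le_pos; [left; now apply Rinv_0_lt_compat|].
    apply sum_ge0; intros; auto using Rmult_le_pos, Rabs_pos, ind_ge0. }
  destruct (far c s x) eqn:Hfar.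
  - eapply Rle_trans; [apply Rmin_r|].
    pose proof (ind_ge0 (itv (c - 4 * s) (8 * s) x)).
    enough (Rabs (mapply al N b x) <=
      sum_f_R0 (fun y => Rabs (b y) * (ind true * Rabs (al x y - al x c))) N).
    { unfold Rdiv; rewrite Rmult_comm.
      assert (0 < / lam) by now apply Rinv_0_lt_compat. nra. }
    replace (mapply al N b x) with (sum_f_R0 (fun y => (al x y - al x c) * b y) N).
    + eapply Rle_trans; [apply Rsum_abs|]; apply sum_le; intros; rewrite Rabs_mult; simpl ind; lra.
    + unfold mapply; rewrite <- (Rminus_0_r (sum_f_R0 (fun y => al x y * b y) N)).
      rewrite <- (Rmult_0_r (al x c)), <- Hb0, <- sum_scal, <- minus_sum.
      apply sum_eq; intros; ring.
  - destruct (itvP (c - 4 * s) (8 * s) x) as [Hi|Hi]; simpl (ind true).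
    + pose proof (Rmin_l 1 (Rabs (mapply al N b x) / lam)); lra.
    + exfalso; apply Hi; unfold far in Hfar; apply orb_false_iff in Hfar.
      rewrite !Nat.leb_gt in Hfar; lia. }
eapply Rle_trans; [apply sum_le; intros x _; apply Hpt|].
rewrite sum_plus, sum_scal, sum_swap.
assert (H1 := sum_itv_le (c - 4 * s) (8 * s) N).
rewrite mult_INR in H1; replace (INR 8) with 8 in H1 by (simpl; ring).
assert (H2 : sum_f_R0 (fun y => sum_f_R0 (fun x =>
    Rabs (b y) * (ind (far c s x) * Rabs (al x y - al x c))) N) N
    <= 3 * C * sum_f_R0 (fun x => Rabs (b x)) N).
{ rewrite <- sum_scal; apply sum_le; intros y _; rewrite sum_scal.
  destruct (itv c s y) eqn:Hy.
  - pose proof (local_part_hormander a C c s y N HC Hsz Hsm Hs Hy).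
    pose proof (Rabs_pos (b y)); unfold al; nra.
  - rewrite Hb, Rabs_R0 by exact Hy; lra. }
assert (Hil : 0 < / lam) by now apply Rinv_0_lt_compat.
assert (0 < INR s) by now apply lt_0_INR.
unfold Rdiv; nra.
Qed.

Lemma pow2_unbounded (x : R) (n : nat) : exists k, x <= INR (2 ^ k) /\ (n < 2 ^ k)%nat.
Proof.
destruct (INR_unbounded x) as [m Hm].
exists (Nat.max m n).
assert (H := Nat.pow_gt_lin_r 2 (Nat.max m n) ltac:(lia)); split; [|lia].
apply Rle_trans with (INR m); [lra | apply le_INR; lia].
Qed.

Lemma mapply_trunc a f M N x : (N <= M)%nat -> mapply a M (trunc N f) x = mapply a N f x.
Proof.
intros HNM; unfold mapply; rewrite <- (sum_trunc _ M N HNM); apply sum_eq; intros y _.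
unfold trunc; destruct (y <=? N)%nat; ring.
Qed.

(** The input is cut at height [lam] within the estimate itself: low values enter through l^2, high
    values through the decomposition. This is the form that interpolation consumes, one level at a
    time. *)
Lemma weak_type (a : nat -> nat -> R) (B C : R) :
  0 <= B -> 0 <= C -> lp_bound 2 a B -> size_bound a C -> smooth_bound a C ->
  exists W, 0 <= W /\ forall N f lam, 0 < lam ->
    sum_f_R0 (fun x => if Rlt_dec lam (Rabs (mapply a N f x)) then 1 else 0) N
    <= W * sum_f_R0 (fun y => if Rle_dec (Rabs (f y)) lam
                              then (f y) ^ 2 / lam ^ 2 else Rabs (f y) / lam) N.
Proof.
intros HB HC Hl2 Hsz Hsm.
(* The summands pay for the l^2 part [u], the local bad part [v] and the global bad part [w]; the
   factors come from testing each against [lam / 3]. *)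
exists (36 * B + 9 * (8 + 3 * C) + 36 * C); split; [lra|]; intros N f lam Hlam.
set (hi := fun y => if Rle_dec (Rabs (f y)) lam then 0 else f y).
set (lo := fun y => if Rle_dec (Rabs (f y)) lam then f y else 0).
set (H := sum_f_R0 (fun y => Rabs (hi y)) N).
set (L := sum_f_R0 (fun y => (lo y) ^ 2) N).
assert (Hil : 0 < / lam) by now apply Rinv_0_lt_compat.
assert (HH : 0 <= H) by (apply sum_ge0; intros; apply Rabs_pos).
assert (HL : 0 <= L) by (apply sum_ge0; intros; apply pow2_ge_0).
assert (HR : sum_f_R0 (fun y => if Rle_dec (Rabs (f y)) lam
      then (f y) ^ 2 / lam ^ 2 else Rabs (f y) / lam) N = / lam ^ 2 * L + / lam * H).
{ unfold L, H; rewrite <- !sum_scal, <- sum_plus; apply sum_eq; intros y _; unfold lo, hi.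
  destruct (Rle_dec (Rabs (f y)) lam); rewrite ?Rabs_R0; unfold Rdiv; ring. }
rewrite HR; clear HR.
(* The initial dyadic interval must contain the support and have average at most [lam]. The section
   is enlarged to it; the truncated input leaves the image unchanged. *)
destruct (pow2_unbounded (H / lam) N) as (k & Hk1 & Hk2).
set (M := (2 ^ k - 1)%nat).
assert (HNM : (N <= M)%nat) by lia.
set (hiN := trunc N hi).
assert (HhiN : sum_f_R0 (fun y => Rabs (hiN y)) M = H).
{ unfold H; rewrite <- (sum_trunc _ M N HNM); apply sum_eq; intros y _; unfold hiN, trunc.
  destruct (y <=? N)%nat; [reflexivity | apply Rabs_R0]. }
destruct (cz_decomposition (capped_sum (local_part a) M lam) M lam (8 + 3 * C)) with
  (k := k) (c := 0%nat) (f := hiN) as (g & _ & Hgb & Hg1 & HgP).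
- exact Hlam.
- lra.
- unfold capped_sum; rewrite sum_const0; [lra|]; intros x _; unfold mapply.
  rewrite sum_const0 by (intros; ring); unfold Rdiv; rewrite Rabs_R0, Rmult_0_l.
  apply Rmin_right; lra.
- intros b1 b2; unfold capped_sum; rewrite <- sum_plus; apply sum_le; intros x _.
  rewrite mapply_plus; now apply Rmin_1_subadd.
- intros c s b Hs Hcs Hb Hb0; now apply capped_sum_atom with (c := c).
- unfold M; lia.
- intros x Hx; unfold hiN, trunc.
  destruct (Nat.leb_spec x N); [|reflexivity].
  destruct (itvP 0 (2 ^ k) x); [discriminate | lia].
- rewrite HhiN; apply (Rmult_le_reg_l (/ lam)); [exact Hil|].
  rewrite <- Rmult_assoc, Rinv_l by lra; unfold Rdiv in Hk1; lra.
- rewrite HhiN in Hg1, HgP.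
  set (loN := trunc N lo).
  set (b := fun x => hiN x - g x) in *.
  (* The low and good parts stay together under the whole matrix, the only one with an l^2 bound;
     just [b] is split along the cone. *)
  set (u := mapply a M (fun y => loN y + g y)).
  set (v := mapply (local_part a) M b).
  set (w := mapply (global_part a) M b).
  assert (Hsplit : forall x, mapply a N f x = u x + v x + w x).
  { intros x; rewrite <- (mapply_trunc a f M N x HNM); unfold u, v, w, mapply.
    rewrite <- !sum_plus; apply sum_eq; intros y _; unfold b, hiN, loN, trunc, lo, hi.
    unfold local_part, global_part.
    destruct (comparable x y), (y <=? N)%nat, (Rle_dec (Rabs (f y)) lam); ring. }
  assert (Hb1 : sum_f_R0 (fun y => Rabs (b y)) M <= 2 * H).
  { apply Rle_trans with (H + sum_f_R0 (fun y => Rabs (g y)) M); [|lra].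
    rewrite <- HhiN, <- sum_plus; apply sum_le; intros y _; unfold b, Rminus.
    rewrite <- (Rabs_Ropp (g y)); apply Rabs_triang. }
  assert (Hw : forall x, Rabs (w x) <= 12 * C * H / (INR x + 1)).
  { intros x; unfold w, mapply; eapply Rle_trans; [apply Rsum_abs|].
    assert (Hx : 0 < / (INR x + 1)) by (apply Rinv_0_lt_compat; pose proof (pos_INR x); lra).
    apply Rle_trans with (6 * C / (INR x + 1) * sum_f_R0 (fun y => Rabs (b y)) M).
    - rewrite <- sum_scal; apply sum_le; intros y _; rewrite Rabs_mult.
      apply Rmult_le_compat_r; [apply Rabs_pos | now apply global_part_bound].
    - unfold Rdiv.
      replace (12 * C * H * / (INR x + 1)) with (6 * C * / (INR x + 1) * (2 * H)) by ring.
      apply Rmult_le_compat_l; [apply Rmult_le_pos|]; lra. }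
  (* Uses (lo + g)^2 <= 2 lo^2 + 2 g^2 together with g^2 <= 2 lam |g|. *)
  assert (Hu : sum_f_R0 (fun x => (u x) ^ 2) M <= B * (2 * L + 4 * lam * H)).
  { specialize (Hl2 M (fun y => loN y + g y)); fold u in Hl2.
    rewrite (sum_eq _ (fun x => (u x) ^ 2)) in Hl2
      by (intros; apply rpow_Rabs_2).
    eapply Rle_trans; [apply Hl2|]; apply Rmult_le_compat_l; [exact HB|].
    apply Rle_trans with (2 * L + 4 * lam * sum_f_R0 (fun y => Rabs (g y)) M);
      [|apply Rplus_le_compat_l, Rmult_le_compat_l; lra].
    unfold L; rewrite <- (sum_trunc _ M N HNM), <- !sum_scal, <- sum_plus.
    apply sum_le; intros y _; rewrite rpow_Rabs_2.
    assert (Hlo : trunc N (fun y => (lo y) ^ 2) y = (loN y) ^ 2)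
      by (unfold loN, trunc; destruct (y <=? N)%nat; ring).
    rewrite Hlo; specialize (Hgb y).
    assert (Hg2 : (g y) ^ 2 <= 2 * lam * Rabs (g y)).
    { rewrite <- (Rabs_pos_eq (g y ^ 2)), <- RPow_abs by apply pow2_ge_0.
      pose proof (Rabs_pos (g y)); nra. }
    pose proof (pow2_ge_0 (loN y - g y)); lra. }
  set (nw := sum_f_R0 (fun x => if Rlt_dec (lam / 3 * (INR x + 1)) (12 * C * H) then 1 else 0) M).
  assert (Hnw : nw <= 12 * C * H / (lam / 3)).
  { apply sum_count_lt; [lra|]; apply Rmult_le_pos; lra. }
  set (cv := capped_sum (local_part a) M lam b) in *.
  (* If the sum of three terms exceeds [lam], one of them exceeds [lam / 3]: Chebyshev for [u], the
     capped functional for [v], counting for [w]. *)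
  apply Rle_trans with (9 * / lam ^ 2 * sum_f_R0 (fun x => (u x) ^ 2) M + 3 * cv + nw).
  + unfold nw, cv, capped_sum; rewrite <- !sum_scal, <- !sum_plus; fold v.
    eapply Rle_trans; [apply (sum_mono _ N M); trivial; intros; destruct Rlt_dec; lra|].
    apply sum_le; intros x _; rewrite Hsplit; specialize (Hw x).
    assert (Hsq : 0 <= / lam ^ 2 * u x ^ 2).
    { apply Rmult_le_pos; [|apply pow2_ge_0]; left; apply Rinv_0_lt_compat; nra. }
    assert (Hmin : 0 <= Rmin 1 (Rabs (v x) / lam)).
    { apply Rmin_glb; [lra | apply Rdiv_le_0_compat; auto using Rabs_pos]. }
    assert (Hwc : lam / 3 < Rabs (w x) -> lam / 3 * (INR x + 1) < 12 * C * H).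
    { intros Hlt; assert (Hx : 0 < INR x + 1) by (pose proof (pos_INR x); lra).
      replace (12 * C * H) with (12 * C * H / (INR x + 1) * (INR x + 1)) by (field; lra).
      apply Rmult_lt_compat_r; lra. }
    destruct (Rlt_dec lam (Rabs (u x + v x + w x))) as [Hbig|];
      [|destruct Rlt_dec; lra].
    destruct (Rlt_dec (lam / 3) (Rabs (w x))) as [Hw3|Hw3].
    { destruct (Rlt_dec _ (12 * C * H)) as [|Hn]; [lra | elim Hn; auto]. }
    assert (Hwn : 0 <= if Rlt_dec (lam / 3 * (INR x + 1)) (12 * C * H) then 1 else 0)
      by (destruct Rlt_dec; lra).
    destruct (Rlt_dec (lam / 3) (Rabs (v x))) as [Hv3|Hv3].
    { assert (/ 3 <= Rmin 1 (Rabs (v x) / lam)); [|lra].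
      apply Rmin_glb; [lra|].
      apply (Rmult_le_reg_r lam); [exact Hlam|]; unfold Rdiv; rewrite Rmult_assoc, Rinv_l; lra. }
    assert (Hu3 : lam / 3 < Rabs (u x)).
    { pose proof (Rabs_triang (u x + v x) (w x)); pose proof (Rabs_triang (u x) (v x)); lra. }
    assert (1 <= 9 * / lam ^ 2 * u x ^ 2); [|lra].
    apply (Rmult_le_reg_r (lam ^ 2)); [nra|].
    replace (9 * / lam ^ 2 * u x ^ 2 * lam ^ 2) with (9 * u x ^ 2) by (field; lra).
    rewrite <- (Rabs_pos_eq (u x ^ 2)), <- RPow_abs by apply pow2_ge_0; nra.
  + replace (12 * C * H / (lam / 3)) with (36 * C * (/ lam * H)) in Hnw by (field; lra).
    replace (3 * (8 + 3 * C) * H / lam) with (3 * (8 + 3 * C) * (/ lam * H)) in HgP by (field; lra).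
    assert (Hu' : 9 * / lam ^ 2 * sum_f_R0 (fun x => (u x) ^ 2) M
        <= 18 * B * (/ lam ^ 2 * L) + 36 * B * (/ lam * H)).
    { apply Rle_trans with (9 * / lam ^ 2 * (B * (2 * L + 4 * lam * H))).
      - apply Rmult_le_compat_l; [|exact Hu].
        apply Rmult_le_pos; [lra | left; apply Rinv_0_lt_compat; nra].
      - right; field; lra. }
    assert (0 <= / lam ^ 2 * L)
      by (apply Rmult_le_pos; [left; apply Rinv_0_lt_compat; nra | exact HL]).
    assert (0 <= / lam * H) by (apply Rmult_le_pos; lra).
    nra.
Qed.

(** * Interpolation *)

(** A discrete layer cake: the largest level below [u] already suffices, as [u] is at most twice
    that level. The floor [eps] replaces the infinitely many lower levels. *)
Lemma rpow_layers (p eps u : R) (L : nat) : 0 < p -> 0 < eps -> 0 <= u -> u <= eps * 2 ^ L ->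
  rpow u p <= rpow eps p
    + sum_f_R0 (fun j => rpow 2 p * (rpow (eps * 2 ^ j) p
                                     * if Rlt_dec (eps * 2 ^ j) u then 1 else 0)) L.
Proof.
intros Hp He Hu.
assert (Hterm : forall j, 0 <= rpow 2 p * (rpow (eps * 2 ^ j) p
                                     * if Rlt_dec (eps * 2 ^ j) u then 1 else 0)).
{ intros j; repeat apply Rmult_le_pos; try apply rpow_ge0; destruct Rlt_dec; lra. }
induction L as [|L IH]; intros HuL.
- pose proof (sum_ge0 _ 0 Hterm); pose proof (rpow_le u eps p); simpl in HuL; lra.
- specialize (Hterm (S L)) as HtS; rewrite tech5.
  destruct (Rle_dec u (eps * 2 ^ L)) as [Hle|Hgt]; [specialize (IH Hle); lra|].
  assert (H1 : rpow u p <= rpow 2 p * (rpow (eps * 2 ^ L) p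
                                     * if Rlt_dec (eps * 2 ^ L) u then 1 else 0)).
  { destruct (Rlt_dec (eps * 2 ^ L) u); [|lra]; rewrite Rmult_1_r, <- rpow_mult;
      [apply rpow_le; simpl in HuL; lra | lra |].
    apply Rmult_le_pos; [lra | apply pow_le; lra]. }
  assert (H2 := sum_single_le _ L L Hterm ltac:(lia)); simpl in H2.
  pose proof (rpow_ge0 eps p); lra.
Qed.

(* The terms are those of two geometric series meeting where [eps * 2 ^ j] passes [v]:
   increasing with ratio [2 ^ (p - 1)] below [v], decreasing with ratio [2 ^ (p - 2)] above. *)
Lemma layer_sum_le (p : R) : 1 < p < 2 -> exists D, 0 <= D /\
  forall eps v L, 0 < eps -> 0 <= v ->
  sum_f_R0 (fun j => rpow (eps * 2 ^ j) p *
     (if Rle_dec v (eps * 2 ^ j) then v ^ 2 / (eps * 2 ^ j) ^ 2 else v / (eps * 2 ^ j))) L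
  <= D * rpow v p.
Proof.
intros Hp.
set (rho := rpow 2 (p - 1)).
assert (Hrho : 1 < rho) by (apply rpow_gt1; lra).
set (sigma := rpow 2 (p - 2)).
assert (Hsigma : 0 < sigma < 1).
{ assert (H1 : 0 < sigma) by (apply rpow_gt0; lra).
  assert (H2 : 1 < rpow 2 (2 - p)) by (apply rpow_gt1; lra).
  assert (H3 : sigma * rpow 2 (2 - p) = 1).
  { unfold sigma; rewrite <- rpow_plus by lra.
    replace (p - 2 + (2 - p)) with 0 by ring; rewrite rpow_Rpower, Rpower_O; lra. }
  nra. }
(* [K1] is the sum of rho^(-i) over i >= 0 and [K2] the sum of sigma^i over i >= 1. The 1 added in
   the final constant is for the first level above [v]. *)
set (K1 := rho / (rho - 1)).
set (K2 := sigma / (1 - sigma)).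
assert (HK1 : K1 * (rho - 1) = rho) by (unfold K1; field; lra).
assert (HK2 : K2 * (1 - sigma) = sigma) by (unfold K2; field; lra).
assert (HK1p : 1 < K1) by nra.
assert (HK2p : 0 < K2) by nra.
exists (K1 + 1 + K2); split; [lra|]; intros eps v L He Hv.
destruct Hv as [Hv| <-].
2:{ rewrite sum_const0, rpow_0; [lra|]; intros; destruct Rle_dec; unfold Rdiv; ring. }
set (lam := fun j => eps * 2 ^ j).
assert (Hlam : forall j, 0 < lam j)
  by (intros j; apply Rmult_lt_0_compat; [exact He | apply pow_lt; lra]).
assert (HlamS : forall j, lam (S j) = 2 * lam j) by (intros j; unfold lam; simpl; ring).
set (A := fun j => rpow (lam j) (p - 1)).
set (E := fun j => rpow (lam j) (p - 2)).
assert (HA : forall j, 0 < A j) by (intros; now apply rpow_gt0).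
assert (HE : forall j, 0 < E j) by (intros; now apply rpow_gt0).
assert (HAS : forall j, A (S j) = rho * A j)
  by (intros j; unfold A; rewrite HlamS, rpow_mult by (try apply Rlt_le, Hlam; lra); reflexivity).
assert (HES : forall j, E (S j) = sigma * E j)
  by (intros j; unfold E; rewrite HlamS, rpow_mult by (try apply Rlt_le, Hlam; lra); reflexivity).
assert (HAp : forall j, rpow (lam j) p = A j * lam j).
{ intros j; unfold A; rewrite <- (rpow_1 (lam j)) at 3 by apply Rlt_le, Hlam.
  rewrite <- rpow_plus by apply Rlt_le, Hlam; f_equal; ring. }
assert (HEp : forall j, rpow (lam j) p = E j * lam j ^ 2).
{ intros j; unfold E; rewrite <- (rpow_2 (lam j)) by apply Rlt_le, Hlam.
  rewrite <- rpow_plus by apply Rlt_le, Hlam; f_equal; ring. }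
assert (HvA : forall j, lam j <= v -> v * A j <= rpow v p).
{ intros j Hj; replace p with (1 + (p - 1)) at 1 by ring.
  rewrite rpow_plus, rpow_1 by lra; apply Rmult_le_compat_l; [lra|]; apply rpow_le; lra. }
assert (HvE : forall j, v <= lam j -> v ^ 2 * E j <= rpow v p).
{ intros j Hj; replace p with (2 + (p - 2)) at 1 by ring.
  rewrite rpow_plus, rpow_2 by lra; apply Rmult_le_compat_l; [nra|]; apply rpow_le_neg; lra. }
set (term := fun j => rpow (lam j) p * (if Rle_dec v (lam j) then v ^ 2 / (lam j) ^ 2 else v / lam j)).
assert (Hterm : forall j, term j = if Rle_dec v (lam j) then v ^ 2 * E j else v * A j).
{ intros j; specialize (Hlam j); unfold term; destruct Rle_dec;
    [rewrite HEp | rewrite HAp]; field; lra. }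
change (sum_f_R0 term L <= (K1 + 1 + K2) * rpow v p).
assert (Hvp := rpow_ge0 v p).
(* Below [v] the last term of a growing geometric sum controls everything; above [v] the subtracted
   term is the whole remaining tail, kept in reserve for the later steps. *)
enough (Hinv : if Rle_dec v (lam L)
   then sum_f_R0 term L <= (K1 + 1 + K2) * rpow v p - K2 * (v ^ 2 * E L)
   else sum_f_R0 term L <= K1 * (v * A L)).
{ destruct (Rle_dec v (lam L)) as [Hl|Hl].
  - assert (0 <= v ^ 2 * E L) by (apply Rmult_le_pos; [nra | apply Rlt_le, HE]); nra.
  - assert (v * A L <= rpow v p) by (apply HvA; lra); nra. }
clear Hp; induction L as [|L IH].
- rewrite sum_0, Hterm; destruct (Rle_dec v (lam 0%nat)) as [Hl|Hl].
  + specialize (HvE _ Hl); nra.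
  + assert (0 <= v * A 0%nat) by (apply Rmult_le_pos; [lra | apply Rlt_le, HA]); nra.
- rewrite tech5, Hterm; specialize (HlamS L); specialize (Hlam L).
  destruct (Rle_dec v (lam (S L))) as [Hl|Hl]; destruct (Rle_dec v (lam L)) as [Hl'|Hl'].
  + rewrite HES; enough (K2 * (v ^ 2 * E L) = (1 + K2) * (v ^ 2 * (sigma * E L))) by lra.
    replace (K2 * (v ^ 2 * E L)) with ((sigma + K2 * sigma) * (v ^ 2 * E L)) by (f_equal; lra); ring.
  + specialize (HvE _ Hl); specialize (HvA L ltac:(lra)); nra.
  + lra.
  + rewrite HAS; enough (K1 * (v * A L) + v * (rho * A L) = K1 * (v * (rho * A L))) by lra.
    replace (K1 * (v * (rho * A L))) with ((K1 * rho) * (v * A L)) by ring.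
    replace (K1 * rho) with (K1 + rho) by lra; ring.
Qed.

Lemma strong_type_lt2 (a : nat -> nat -> R) (p B C : R) :
  1 < p < 2 -> 0 <= B -> 0 <= C -> lp_bound 2 a B -> size_bound a C -> smooth_bound a C ->
  exists B', 0 <= B' /\ lp_bound p a B'.
Proof.
intros Hp HB HC Hl2 Hsz Hsm.
destruct (weak_type a B C HB HC Hl2 Hsz Hsm) as (W & HW & Hweak).
destruct (layer_sum_le p Hp) as (D & HD & Hlayer).
assert (H2 := rpow_ge0 2 p).
exists (rpow 2 p * W * D); split; [repeat apply Rmult_le_pos; lra|]; intros N f.
(* The floor of the layers costs [eps] to the power [p] at each of the N + 1 points; [eps] is chosen
   so that the total is [delta], while the main bound does not depend on [eps]. *)
apply le_epsilon; intros delta Hdelta.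
assert (HN : 0 < INR (S N)) by (apply lt_0_INR; lia).
assert (HdN : 0 < delta / INR (S N)) by now apply Rdiv_lt_0_compat.
set (eps := rpow (delta / INR (S N)) (/ p)).
assert (He : 0 < eps) by now apply rpow_gt0.
assert (Hep : rpow eps p = delta / INR (S N)) by (apply rpow_inv_r; lra).
set (u := fun x => Rabs (mapply a N f x)).
destruct (pow2_unbounded (sum_f_R0 u N / eps) 0) as (L & HL & _).
rewrite pow_INR in HL; change (INR 2) with 2 in HL.
assert (HuL : forall x, (x <= N)%nat -> u x <= eps * 2 ^ L).
{ intros x Hx; apply Rle_trans with (sum_f_R0 u N).
  - apply sum_single_le; [intros; apply Rabs_pos | exact Hx].
  - apply (Rmult_le_reg_r (/ eps)); [now apply Rinv_0_lt_compat|].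
    replace (eps * 2 ^ L * / eps) with (2 ^ L) by (field; lra); exact HL. }
eapply Rle_trans.
{ apply sum_le; intros x Hx.
  apply (rpow_layers p eps (u x) L); [lra | exact He | apply Rabs_pos | now apply HuL]. }
rewrite sum_plus, sum_cte, Hep, sum_swap, Rplus_comm.
apply Rplus_le_compat; [|right; field; lra].
rewrite !Rmult_assoc.
rewrite (sum_eq _ (fun j => rpow 2 p * (rpow (eps * 2 ^ j) p *
   sum_f_R0 (fun x => if Rlt_dec (eps * 2 ^ j) (u x) then 1 else 0) N)))
  by (intros; now rewrite <- !sum_scal).
rewrite sum_scal; apply Rmult_le_compat_l; [exact H2|].
eapply Rle_trans.
{ apply sum_le; intros j _; apply Rmult_le_compat_l; [apply rpow_ge0|].
  apply Hweak; apply Rmult_lt_0_compat; [exact He | apply pow_lt; lra]. }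
rewrite (sum_eq _ (fun j => W * sum_f_R0 (fun y => rpow (eps * 2 ^ j) p *
   (if Rle_dec (Rabs (f y)) (eps * 2 ^ j) then (f y) ^ 2 / (eps * 2 ^ j) ^ 2
    else Rabs (f y) / (eps * 2 ^ j))) N))
  by (intros; rewrite sum_scal; ring).
rewrite sum_scal; apply Rmult_le_compat_l; [exact HW|].
rewrite sum_swap, <- sum_scal; apply sum_le; intros y _.
rewrite <- (Rabs_pos_eq (f y ^ 2)), <- RPow_abs by apply pow2_ge_0.
apply Hlayer; [exact He | apply Rabs_pos].
Qed.

Lemma strong_type (a : nat -> nat -> R) (p B C : R) :
  1 < p -> 0 <= B -> 0 <= C -> lp_bound 2 a B -> size_bound a C ->
  smooth_bound a C -> smooth_bound (transpose a) C ->
  exists B', 0 <= B' /\ lp_bound p a B'.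
Proof.
intros Hp HB HC Hl2 Hsz Hsm Hsmt.
destruct (total_order_T p 2) as [[Hp2| ->]|Hp2].
- now apply strong_type_lt2 with B C.
- now exists B.
- destruct (lp_bound_transpose 2 2 B a) as (Bt & HBt & Hl2t); trivial; [lra | lra |].
  assert (Hszt : size_bound (transpose a) C).
  { intros x y Hxy; rewrite Rabs_minus_sym; now apply Hsz, not_eq_sym. }
  set (q := p / (p - 1)).
  assert (Hq : 1 < q < 2).
  { unfold q; split; apply (Rmult_lt_reg_r (p - 1)); try lra;
      unfold Rdiv; rewrite (Rmult_assoc p), Rinv_l; lra. }
  destruct (strong_type_lt2 (transpose a) q Bt C) as (Bq & HBq & Hlq); trivial.
  (* Transposing twice returns [a] by conversion. *)
  apply (lp_bound_transpose q p Bq (transpose a)); trivial; [lra|].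
  unfold q; field; split; [lra|].
  unfold Rdiv; lra.
Qed.

(** * Nonnegative series and [in_lp] *)

Lemma ex_series_bounded (a : nat -> R) (M : R) :
  (forall k, 0 <= a k) -> (forall n, sum_n a n <= M) -> ex_series a /\ Series a <= M.
Proof.
intros Ha HM.
assert (Hlim : ex_finite_lim_seq (sum_n a)).
{ apply ex_finite_lim_seq_incr with M; [|exact HM].
  intros n; rewrite sum_Sn; unfold plus; simpl; specialize (Ha (S n)); lra. }
destruct Hlim as [l Hl]; split; [now exists l|].
rewrite (is_series_unique a l Hl).
exact (is_lim_seq_le _ _ _ _ HM Hl (is_lim_seq_const M)).
Qed.

Lemma is_lim_sum_n_Series (a : nat -> R) : ex_series a -> is_lim_seq (sum_n a) (Series a).
Proof. intros Ha; exact (Series_correct a Ha). Qed.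

Lemma sum_n_le_Series (a : nat -> R) (n : nat) :
  (forall k, 0 <= a k) -> ex_series a -> sum_n a n <= Series a.
Proof.
intros Ha Hex; apply is_lim_seq_incr_compare; [now apply is_lim_sum_n_Series|].
intros k; rewrite sum_Sn; unfold plus; simpl; specialize (Ha (S k)); lra.
Qed.

Lemma lp_terms_ge0 p f k : 0 <= lp_terms p f k.
Proof. apply Rplus_le_le_0_compat; apply rpow_ge0. Qed.

Lemma point_le_sum_lp_terms p f (n : Z) :
  rpow (Cmod (f n)) p <= sum_n (lp_terms p f) (Z.abs_nat n).
Proof.
rewrite sum_n_Reals.
destruct (Z.le_gt_cases 0 n) as [Hn|Hn].
- apply Rle_trans with (lp_terms p f (Z.abs_nat n)).
  + unfold lp_terms; replace (Z.of_nat (Z.abs_nat n)) with n at 1 by lia.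
    pose proof (rpow_ge0 (Cmod (f (- Z.of_nat (Z.abs_nat n) - 1)%Z)) p); lra.
  + apply sum_single_le; [apply lp_terms_ge0 | lia].
- apply Rle_trans with (lp_terms p f (Z.abs_nat n - 1)).
  + unfold lp_terms; replace (- Z.of_nat (Z.abs_nat n - 1) - 1)%Z with n by lia.
    pose proof (rpow_ge0 (Cmod (f (Z.of_nat (Z.abs_nat n - 1)))) p); lra.
  + apply sum_single_le; [apply lp_terms_ge0 | lia].
Qed.

Lemma in_lp_supp p f N : supp_in f N -> in_lp p f.
Proof.
intros Hf; apply (ex_series_bounded _ (sum_n (lp_terms p f) N)); [apply lp_terms_ge0|].
assert (H0 : forall n, (N < n)%nat -> lp_terms p f n = 0).
{ intros n Hn; unfold lp_terms; rewrite !Hf, Cmod_0, rpow_0 by lia; ring. }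
intros n; rewrite !sum_n_Reals.
destruct (Nat.le_gt_cases n N) as [HnN|HnN]; [apply sum_mono; trivial; apply lp_terms_ge0|].
right; symmetry; rewrite <- (sum_trunc _ n N) by lia; apply sum_eq; intros i _; unfold trunc.
destruct (Nat.leb_spec i N); [reflexivity | now rewrite H0].
Qed.

(** Passes from norms to p-th power sums. The given constant has no prescribed sign, hence
    [Rabs B]. *)
Lemma bounded_op_Series p T : 0 < p -> lp_bounded_op p T ->
  exists B, 0 <= B /\ forall f, in_lp p f ->
    in_lp p (T f) /\ Series (lp_terms p (T f)) <= B * Series (lp_terms p f).
Proof.
intros Hp [_ [B HB]]; exists (rpow (Rabs B) p); split; [apply rpow_ge0|]; intros f Hf.
destruct (HB f Hf) as [HTf Hle]; split; [exact HTf|].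
assert (Hpos : forall g, in_lp p g -> 0 <= Series (lp_terms p g)).
{ intros g Hg; apply Rle_trans with (sum_n (lp_terms p g) 0).
  - rewrite sum_O; apply lp_terms_ge0.
  - apply sum_n_le_Series; [apply lp_terms_ge0 | exact Hg]. }
rewrite <- (rpow_inv_r (Series (lp_terms p (T f))) p) by auto.
rewrite <- (rpow_inv_r (Series (lp_terms p f)) p) by auto.
rewrite <- rpow_mult by (try apply rpow_ge0; apply Rabs_pos).
apply rpow_le; [lra|]; unfold lp_norm in Hle.
eapply Rle_trans; [apply Hle|]; apply Rmult_le_compat_r; [apply rpow_ge0 | apply Rle_abs].
Qed.

Lemma lp_norm_le_of_Series p B f g : 0 < p -> 0 <= B -> 0 <= Series (lp_terms p f) ->
  Series (lp_terms p g) <= B * Series (lp_terms p f) ->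
  lp_norm p g <= rpow B (/ p) * lp_norm p f.
Proof.
intros Hp HB Hf Hle; unfold lp_norm; rewrite <- rpow_mult by assumption.
apply rpow_le; [left; now apply Rinv_0_lt_compat | exact Hle].
Qed.

(** * Folding [Z] onto [nat] *)

(** Both sides contain 0, whereas [lp_terms] pairs [k] with [-k-1]; this accounts for the index
    shifts below. *)
Definition signed (d : bool) (j : nat) : Z := if d then Z.of_nat j else (- Z.of_nat j)%Z.

Lemma sum_side_le (G : Z -> R) (e : bool) (N : nat) : (forall n, 0 <= G n) ->
  sum_f_R0 (fun i => G (signed e i)) N
  <= sum_f_R0 (fun k => G (Z.of_nat k) + G (- Z.of_nat k - 1)%Z) N.
Proof.
intros HG; destruct e; simpl signed.
- apply sum_le; intros i _; specialize (HG (- Z.of_nat i - 1)%Z); lra.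
(* The negative side lags by one index behind the pairs, so the induction carries the term not yet
   matched. *)
- enough (sum_f_R0 (fun i => G (- Z.of_nat i)%Z) N + G (- Z.of_nat N - 1)%Z
    <= sum_f_R0 (fun k => G (Z.of_nat k) + G (- Z.of_nat k - 1)%Z) N)
    by (specialize (HG (- Z.of_nat N - 1)%Z); lra).
  induction N as [|N IH]; [simpl; lra|]; rewrite !tech5.
  replace (- Z.of_nat (S N))%Z with (- Z.of_nat N - 1)%Z at 1 by lia.
  specialize (HG (Z.of_nat (S N))); lra.
Qed.

Lemma sum_le_sides (G : Z -> R) (N : nat) : (forall n, 0 <= G n) ->
  sum_f_R0 (fun k => G (Z.of_nat k) + G (- Z.of_nat k - 1)%Z) N
  <= sum_f_R0 (fun i => G (signed true i)) (S N) + sum_f_R0 (fun i => G (signed false i)) (S N).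
Proof.
intros HG; simpl signed; rewrite sum_plus.
assert (H1 := sum_mono (fun i => G (Z.of_nat i)) N (S N) (fun i => HG (Z.of_nat i)) ltac:(lia)).
enough (H2 : sum_f_R0 (fun i => G (- Z.of_nat i - 1)%Z) N
             <= sum_f_R0 (fun i => G (- Z.of_nat i)%Z) (S N)) by lra.
rewrite (decomp_sum _ (S N)) by lia; simpl pred.
rewrite (sum_eq (fun i => G (- Z.of_nat i - 1)%Z) (fun i => G (- Z.of_nat (S i))%Z))
  by (intros; f_equal; lia).
specialize (HG (- Z.of_nat 0)%Z); lra.
Qed.

Definition delta (m k : Z) : C := if Z.eqb k m then RtoC 1 else RtoC 0.

Definition emb (d : bool) (F : nat -> R) (m : Z) : C :=
  if Z.eqb m (signed d (Z.abs_nat m)) then RtoC (F (Z.abs_nat m)) else RtoC 0.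

Lemma supp_delta m : supp_in (delta m) (Z.abs_nat m).
Proof. intros k Hk; unfold delta; destruct (Z.eqb_spec k m); [lia | reflexivity]. Qed.

Lemma supp_emb d F N : supp_in (emb d (trunc N F)) N.
Proof.
intros k Hk; unfold emb, trunc.
destruct (Nat.leb_spec (Z.abs_nat k) N); [lia|]; now destruct Z.eqb.
Qed.

Lemma Cmod_emb_le d F m : Cmod (emb d F m) <= Rabs (F (Z.abs_nat m)).
Proof.
unfold emb; destruct Z.eqb; rewrite Cmod_R; [lra|]; rewrite Rabs_R0; apply Rabs_pos.
Qed.

Lemma abs_signed d j : Z.abs_nat (signed d j) = j.
Proof. destruct d; simpl; lia. Qed.

Lemma Series_emb_le p d F N : 0 <= p ->
  Series (lp_terms p (emb d (trunc N F))) <= 2 * sum_f_R0 (fun j => rpow (Rabs (F j)) p) N.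
Proof.
intros Hp; apply ex_series_bounded; [apply lp_terms_ge0|]; intros n; rewrite sum_n_Reals.
unfold lp_terms.
eapply Rle_trans;
  [apply (sum_le_sides (fun m => rpow (Cmod (emb d (trunc N F) m)) p)); intros; apply rpow_ge0|].
assert (Hside : forall e, sum_f_R0 (fun i => rpow (Cmod (emb d (trunc N F) (signed e i))) p) (S n)
                  <= sum_f_R0 (fun j => rpow (Rabs (F j)) p) N).
{ intros e.
  rewrite <- (sum_trunc _ (Nat.max N (S n)) N) by lia.
  assert (Hge : forall i, 0 <= trunc N (fun j => rpow (Rabs (F j)) p) i)
    by (intros i; unfold trunc; destruct (i <=? N)%nat; [apply rpow_ge0 | lra]).
  eapply Rle_trans; [|apply (sum_mono _ (S n)); [exact Hge | lia]].
  apply sum_le; intros i _.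
  eapply Rle_trans; [apply rpow_le; [exact Hp | apply Cmod_emb_le]|]; rewrite abs_signed.
  unfold trunc; destruct (i <=? N)%nat; [lra | rewrite Rabs_R0, rpow_0; lra]. }
pose proof (Hside true); pose proof (Hside false); lra.
Qed.

(** * Real matrix blocks of [T] *)

Definition part (r : bool) (z : C) : R := if r then Re z else Im z.

Lemma part_plus r z w : part r (Cplus z w) = part r z + part r w.
Proof. destruct r; reflexivity. Qed.

Lemma part_minus r z w : part r (Cminus z w) = part r z - part r w.
Proof. destruct r; reflexivity. Qed.

Lemma part_scal r (c : R) z : part r (Cmult (RtoC c) z) = c * part r z.
Proof. destruct r; unfold part, Re, Im; simpl; ring. Qed.

Lemma part_le_Cmod r z : Rabs (part r z) <= Cmod z.
Proof.
destruct r; simpl; eapply Rle_trans; try apply Rmax_Cmod; [apply Rmax_l | apply Rmax_r].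
Qed.

Lemma Cmod_le_parts z : Cmod z <= Rabs (part true z) + Rabs (part false z).
Proof.
destruct z as [x y]; unfold part, Re, Im; simpl.
replace (x, y) with (Cplus (RtoC x) (Cmult Ci (RtoC y)))
  by (unfold Cplus, Cmult, Ci, RtoC; simpl; f_equal; ring).
eapply Rle_trans; [apply Cmod_triangle|].
rewrite Cmod_mult, Cmod_Ci, !Cmod_R; lra.
Qed.

Definition block (T : (Z -> C) -> Z -> C) (r e d : bool) (i j : nat) : R :=
  part r (T (delta (signed d j)) (signed e i)).

(** The embedded truncation is a finite combination of [delta] functions with real coefficients, and
    real scalars commute with [part r]. *)
Lemma block_apply T r e d N F i : lp_linear 2 T ->
  mapply (block T r e d) N F i = part r (T (emb d (trunc N F)) (signed e i)).
Proof.
intros [Hadd Hscal]; unfold mapply, block.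
assert (Hsd : forall m, in_lp 2 (delta m)) by (intros; eapply in_lp_supp, supp_delta).
induction N as [|N IH].
- rewrite sum_0; replace (emb d (trunc 0 F))
    with (fun k => Cmult (RtoC (F 0%nat)) (delta (signed d 0) k)).
  + rewrite Hscal by auto; rewrite part_scal; ring.
  + apply functional_extensionality; intros k; unfold emb, trunc, delta.
    destruct (Z.eqb_spec k (signed d 0)) as [->|Hk].
    * rewrite abs_signed, Z.eqb_refl; simpl; ring.
    * destruct (Z.eqb_spec k (signed d (Z.abs_nat k))) as [Hk'|]; [|ring].
      destruct (Nat.leb_spec (Z.abs_nat k) 0); [|ring].
      exfalso; apply Hk; rewrite Hk'; f_equal; lia.
- rewrite tech5, IH; replace (emb d (trunc (S N) F))
    with (fun k => Cplus (emb d (trunc N F) k)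
                         (Cmult (RtoC (F (S N))) (delta (signed d (S N)) k))).
  + rewrite Hadd, Hscal, part_plus, part_scal; [ring | auto | | ].
    * eapply in_lp_supp, supp_emb.
    * apply (in_lp_supp _ _ (S N)); intros k Hk; unfold delta.
      destruct (Z.eqb_spec k (signed d (S N))); [|ring].
      destruct d; simpl in *; lia.
  + apply functional_extensionality; intros k; unfold emb, trunc, delta.
    destruct (Z.eqb_spec k (signed d (S N))) as [->|Hk].
    * rewrite abs_signed, Z.eqb_refl, (proj2 (Nat.leb_gt (S N) N)), Nat.leb_refl by lia; ring.
    * destruct (Z.eqb_spec k (signed d (Z.abs_nat k))) as [Hk'|]; [|ring].
      destruct (Nat.leb_spec (Z.abs_nat k) N), (Nat.leb_spec (Z.abs_nat k) (S N)); try lia; try ring.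
      exfalso; apply Hk; rewrite Hk'; f_equal; lia.
Qed.

Lemma zsum_delta (g : Z -> C) (m : Z) (N : nat) : (Z.abs m <= Z.of_nat N)%Z ->
  zsum (fun k => Cmult (g k) (delta m k)) N = g m.
Proof.
intros Hm; unfold zsum.
assert (Hs : forall M, sum_n (fun k : nat => Cmult (g (Z.of_nat k - Z.of_nat N)%Z)
     (delta m (Z.of_nat k - Z.of_nat N)%Z)) M
   = if Z.leb m (Z.of_nat M - Z.of_nat N) then g m else RtoC 0).
{ assert (Ht : forall k : Z, Cmult (g k) (delta m k) = if Z.eqb k m then g m else RtoC 0).
  { intros k; unfold delta; destruct (Z.eqb_spec k m) as [->|]; ring. }
  induction M as [|M IH]; [rewrite sum_O | rewrite sum_Sn, IH]; rewrite Ht.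
  - destruct (Z.eqb_spec (Z.of_nat 0 - Z.of_nat N) m), (Z.leb_spec m (Z.of_nat 0 - Z.of_nat N));
      trivial; lia.
  - destruct (Z.eqb_spec (Z.of_nat (S M) - Z.of_nat N) m), (Z.leb_spec m (Z.of_nat M - Z.of_nat N)),
      (Z.leb_spec m (Z.of_nat (S M) - Z.of_nat N)); try lia; unfold plus; simpl; ring. }
rewrite Hs; destruct (Z.leb_spec m (Z.of_nat (2 * N) - Z.of_nat N)); [reflexivity | lia].
Qed.

(** * Kernel hypotheses transferred to the blocks *)

Definition has_kernel (T : (Z -> C) -> Z -> C) (K : Z -> Z -> C) : Prop :=
  forall (f : Z -> C) (N : nat), supp_in f N ->
     forall n : Z, f n = 0%C -> f (- n)%Z = 0%C ->
       T f n = zsum (fun m => Cmult (K n m) (f m)) N.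

Definition kernel_size (K : Z -> Z -> C) (C0 : R) : Prop :=
  forall n m : Z, Z.abs n <> Z.abs m -> Cmod (K n m) <= C0 / IZR (Z.abs (n - m)).

Definition kernel_smooth (K : Z -> Z -> C) (C0 : R) : Prop :=
  forall m n l : Z,
     IZR (Z.abs (Z.abs m - Z.abs n)) > 2 * IZR (Z.abs (m - l)) ->
     IZR (Z.abs n) / 2 <= IZR (Z.abs m) <= 3 * IZR (Z.abs n) / 2 ->
     IZR (Z.abs n) / 2 <= IZR (Z.abs l) <= 3 * IZR (Z.abs n) / 2 ->
     Cmod (Cminus (K n m) (K n l)) + Cmod (Cminus (K m n) (K l n))
       <= C0 * IZR (Z.abs (m - l)) / (IZR (Z.abs m - Z.abs n)) ^ 2.

Lemma kernel_size_ge0 K C0 : kernel_size K C0 -> 0 <= C0.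
Proof.
intros H; specialize (H 0%Z 1%Z ltac:(simpl; lia)); simpl in H.
pose proof (Cmod_ge_0 (K 0%Z 1%Z)); lra.
Qed.

(** [i <> j] says precisely that the point mass vanishes at both the output point and its
    reflection, as the kernel formula requires. *)
Lemma block_kernel T K r e d i j : has_kernel T K -> i <> j ->
  block T r e d i j = part r (K (signed e i) (signed d j)).
Proof.
intros HK Hij; unfold block; f_equal.
rewrite (HK (delta (signed d j)) j).
- apply zsum_delta; destruct d; simpl; lia.
- intros k Hk; unfold delta; destruct (Z.eqb_spec k (signed d j)); [|reflexivity].
  destruct d; simpl in *; lia.
- unfold delta; destruct (Z.eqb_spec (signed e i) (signed d j)); [|reflexivity].
  destruct d, e; simpl in *; lia.
- unfold delta; destruct (Z.eqb_spec (- signed e i) (signed d j)); [|reflexivity].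
  destruct d, e; simpl in *; lia.
Qed.

Lemma IZR_abs_INR (i j : nat) :
  IZR (Z.abs (Z.of_nat i - Z.of_nat j)) = Rabs (INR i - INR j).
Proof. now rewrite abs_IZR, minus_IZR, <- !INR_IZR_INZ. Qed.

Lemma signed_minus_abs d i j :
  Z.abs (signed d i - signed d j) = Z.abs (Z.of_nat i - Z.of_nat j).
Proof. destruct d; simpl; lia. Qed.

Lemma Zabs_signed d j : Z.abs (signed d j) = Z.of_nat j.
Proof. destruct d; simpl; lia. Qed.

(** For equal signs the distances agree; for opposite signs the distance on Z is i + j, which only
    helps. *)
Lemma block_size T K C0 r e d : has_kernel T K -> kernel_size K C0 ->
  size_bound (block T r e d) C0.
Proof.
intros HK Hsz i j Hij; rewrite (block_kernel T K) by assumption.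
eapply Rle_trans; [apply part_le_Cmod|].
eapply Rle_trans; [apply Hsz; rewrite !Zabs_signed; lia|].
apply Rmult_le_compat_l; [now apply (kernel_size_ge0 K)|].
apply Rinv_le_contravar.
- apply Rabs_pos_lt; intros H; apply Hij, INR_eq; lra.
- rewrite <- IZR_abs_INR; apply IZR_le; destruct d, e; simpl; lia.
Qed.

Lemma comparable_halves x y : comparable x y = true ->
  IZR (Z.of_nat x) / 2 <= IZR (Z.of_nat y) <= 3 * IZR (Z.of_nat x) / 2.
Proof.
intros H; destruct (comparableP x y) as [[H1 H2]|]; [|discriminate].
rewrite <- !INR_IZR_INZ.
apply le_INR in H1, H2; rewrite !mult_INR in H1, H2.
replace (INR 3) with 3 in * by (simpl; ring); change (INR 2) with 2 in *.
pose proof (pos_INR x); pose proof (pos_INR y); lra.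
Qed.

(** Keeping the two varying points on the same side [d] makes their distance on Z equal to |c - y|.
    The first difference serves the blocks, the second their transposes. *)
Lemma kernel_smooth_signed K C0 (e d : bool) (x c y : nat) : kernel_smooth K C0 ->
  2 * Rabs (INR c - INR y) < Rabs (INR c - INR x) ->
  comparable x c = true -> comparable x y = true ->
  Cmod (Cminus (K (signed e x) (signed d c)) (K (signed e x) (signed d y)))
  + Cmod (Cminus (K (signed d c) (signed e x)) (K (signed d y) (signed e x)))
  <= C0 * Rabs (INR c - INR y) / (INR c - INR x) ^ 2.
Proof.
intros Hsm Hlt Hxc Hxy.
specialize (Hsm (signed d c) (signed e x) (signed d y)).
rewrite !Zabs_signed, signed_minus_abs, !IZR_abs_INR, minus_IZR, <- (INR_IZR_INZ c),
  <- (INR_IZR_INZ x), (INR_IZR_INZ x), (INR_IZR_INZ c) in Hsm.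
rewrite (INR_IZR_INZ c), (INR_IZR_INZ x) in *.
apply Hsm; [lra | |]; now apply comparable_halves.
Qed.

Lemma block_smooth T K C0 r e d : has_kernel T K -> kernel_smooth K C0 ->
  smooth_bound (block T r e d) C0.
Proof.
intros HK Hsm x c y Hlt Hxc Hxy.
assert (Hx : x <> c /\ x <> y).
{ pose proof (Rabs_pos (INR c - INR y)); split; intros ->; [|lra].
  rewrite Rminus_diag, Rabs_R0 in Hlt; lra. }
rewrite !(block_kernel T K), <- part_minus by tauto.
eapply Rle_trans; [apply part_le_Cmod|].
eapply Rle_trans; [|apply (kernel_smooth_signed K C0 e d x c y); assumption].
pose proof (Cmod_ge_0 (Cminus (K (signed d c) (signed e x)) (K (signed d y) (signed e x)))); lra.
Qed.

Lemma block_smooth_transpose T K C0 r e d : has_kernel T K -> kernel_smooth K C0 ->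
  smooth_bound (transpose (block T r e d)) C0.
Proof.
intros HK Hsm x c y Hlt Hxc Hxy; unfold transpose.
assert (Hx : x <> c /\ x <> y).
{ pose proof (Rabs_pos (INR c - INR y)); split; intros ->; [|lra].
  rewrite Rminus_diag, Rabs_R0 in Hlt; lra. }
rewrite !(block_kernel T K), <- part_minus by (solve [assumption | apply not_eq_sym; tauto]).
eapply Rle_trans; [apply part_le_Cmod|].
eapply Rle_trans; [|apply (kernel_smooth_signed K C0 d e x c y); assumption].
pose proof (Cmod_ge_0 (Cminus (K (signed d x) (signed e c)) (K (signed d x) (signed e y)))); lra.
Qed.

(** A section is [T] preceded by an embedding and followed by a restriction, so its bound is
    inherited uniformly in [N]. *)
Lemma block_l2 T r e d : lp_bounded_op 2 T ->
  exists B, 0 <= B /\ lp_bound 2 (block T r e d) B.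
Proof.
intros HT; destruct (bounded_op_Series 2 T ltac:(lra) HT) as (B & HB & HTB).
exists (B * 2); split; [lra|]; intros N F.
set (g := emb d (trunc N F)).
destruct (HTB g) as [HTg Hle]; [eapply in_lp_supp, supp_emb|].
apply Rle_trans with (sum_f_R0 (fun i => rpow (Cmod (T g (signed e i))) 2) N).
{ apply sum_le; intros i _; rewrite block_apply by apply HT.
  apply rpow_le; [lra | apply part_le_Cmod]. }
eapply Rle_trans;
  [apply (sum_side_le (fun n => rpow (Cmod (T g n)) 2)); intros; apply rpow_ge0|].
change (sum_f_R0 (lp_terms 2 (T g)) N <= B * 2 * sum_f_R0 (fun y => rpow (Rabs (F y)) 2) N).
rewrite <- sum_n_Reals.
eapply Rle_trans; [apply sum_n_le_Series; [apply lp_terms_ge0 | exact HTg]|].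
eapply Rle_trans; [exact Hle|]; rewrite Rmult_assoc; apply Rmult_le_compat_l; [exact HB|].
apply Series_emb_le; lra.
Qed.

Lemma bool_uniform_bound (P : bool -> R -> Prop) :
  (forall b B B', B <= B' -> P b B -> P b B') ->
  (forall b, exists B, 0 <= B /\ P b B) -> exists B, 0 <= B /\ forall b, P b B.
Proof.
intros Hmono H; destruct (H true) as (B1 & HB1 & H1), (H false) as (B2 & HB2 & H2).
exists (B1 + B2); split; [lra|].
intros []; [apply (Hmono _ B1) | apply (Hmono _ B2)]; trivial; lra.
Qed.

Lemma lp_bound_mono p a B B' : B <= B' -> lp_bound p a B -> lp_bound p a B'.
Proof.
intros HB Ha N f; eapply Rle_trans; [apply Ha|]; apply Rmult_le_compat_r; [|exact HB].
apply sum_ge0; intros; apply rpow_ge0.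
Qed.

Lemma block_lp T K C0 p : lp_bounded_op 2 T -> has_kernel T K -> kernel_size K C0 ->
  kernel_smooth K C0 -> 1 < p ->
  exists B, 0 <= B /\ forall r e d, lp_bound p (block T r e d) B.
Proof.
intros HT HK Hsz Hsm Hp.
apply (bool_uniform_bound (fun r B => forall e d, lp_bound p (block T r e d) B)).
{ intros; eapply lp_bound_mono; eauto. }
intros r; apply (bool_uniform_bound (fun e B => forall d, lp_bound p (block T r e d) B)).
{ intros; eapply lp_bound_mono; eauto. }
intros e; apply (bool_uniform_bound (fun d B => lp_bound p (block T r e d) B)).
{ intros; eapply lp_bound_mono; eauto. }
intros d; destruct (block_l2 T r e d HT) as (B2 & HB2 & Hl2).
apply (strong_type _ p B2 C0); trivial.
- now apply (kernel_size_ge0 K).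
- now apply (block_size T K).
- now apply (block_smooth T K).
- now apply (block_smooth_transpose T K).
Qed.

(** * Finitely supported functions *)

Lemma side_part_bound T p B e d F N : lp_linear 2 T -> 0 <= p ->
  (forall r e d, lp_bound p (block T r e d) B) ->
  sum_f_R0 (fun i => rpow (Cmod (T (emb d (trunc N F)) (signed e i))) p) N
  <= rpow 2 p * (2 * B) * sum_f_R0 (fun j => rpow (Rabs (F j)) p) N.
Proof.
intros HT Hp HB.
assert (H1 := HB true e d N F); assert (H2 := HB false e d N F).
apply Rle_trans with (rpow 2 p *
   (sum_f_R0 (fun i => rpow (Rabs (mapply (block T true e d) N F i)) p) N
    + sum_f_R0 (fun i => rpow (Rabs (mapply (block T false e d) N F i)) p) N)).
- rewrite <- sum_plus, <- sum_scal; apply sum_le; intros i _; rewrite !block_apply by exact HT.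
  eapply Rle_trans; [apply rpow_le; [exact Hp | apply Cmod_le_parts]|].
  apply rpow_add_le; auto using Rabs_pos.
- rewrite Rmult_assoc; apply Rmult_le_compat_l; [apply rpow_ge0 | lra].
Qed.

(** The value at 0 is assigned to the positive side alone; otherwise the two sides would count it
    twice. *)
Definition half (s d : bool) (f : Z -> C) (j : nat) : R :=
  if andb (negb d) (j =? 0)%nat then 0 else part s (f (signed d j)).

Lemma half_le s d f j : Rabs (half s d f j) <= Cmod (f (signed d j)).
Proof.
unfold half; destruct (_ && _); [rewrite Rabs_R0; apply Cmod_ge_0 | apply part_le_Cmod].
Qed.

Definition side (d : bool) (f : Z -> C) (N : nat) (m : Z) : C :=
  Cplus (emb d (trunc N (half true d f)) m) (Cmult Ci (emb d (trunc N (half false d f)) m)).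

Lemma supp_split f N : supp_in f N -> f = fun m => Cplus (side true f N m) (side false f N m).
Proof.
intros Hf; apply functional_extensionality; intros m; unfold side, emb, trunc, half.
destruct (Z.le_gt_cases (Z.abs m) (Z.of_nat N)) as [Hm|Hm].
- rewrite (proj2 (Nat.leb_le (Z.abs_nat m) N)) by lia.
  destruct (Z.le_gt_cases 0 m) as [H0|H0].
  + assert (E : signed true (Z.abs_nat m) = m) by (simpl; lia).
    rewrite E, Z.eqb_refl; simpl.
    destruct (Z.eqb_spec m (- Z.of_nat (Z.abs_nat m))).
    * rewrite (proj2 (Nat.eqb_eq (Z.abs_nat m) 0)) by lia.
      destruct (f m) as [u v]; unfold Cplus, Cmult, Ci, RtoC, Re, Im; simpl; f_equal; ring.
    * destruct (f m) as [u v]; unfold Cplus, Cmult, Ci, RtoC, Re, Im; simpl; f_equal; ring.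
  + assert (E : signed false (Z.abs_nat m) = m) by (simpl; lia).
    rewrite E, Z.eqb_refl; simpl.
    rewrite (proj2 (Nat.eqb_neq (Z.abs_nat m) 0)) by lia.
    destruct (Z.eqb_spec m (Z.of_nat (Z.abs_nat m))); [lia|].
    destruct (f m) as [u v]; unfold Cplus, Cmult, Ci, RtoC, Re, Im; simpl; f_equal; ring.
- rewrite (proj2 (Nat.leb_gt (Z.abs_nat m) N)), Hf by lia.
  destruct (Z.eqb _ _), (Z.eqb _ _); ring.
Qed.

(** Each factor [rpow 2 p] pays for one splitting into real and imaginary parts, of the output and
    of the input. *)
Lemma side_bound T p B e d f N : lp_linear 2 T -> 0 <= p -> 0 <= B ->
  (forall r e d, lp_bound p (block T r e d) B) ->
  sum_f_R0 (fun i => rpow (Cmod (T (side d f N) (signed e i))) p) N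
  <= rpow 2 p * (rpow 2 p * (4 * B)) * sum_f_R0 (lp_terms p f) N.
Proof.
intros HT Hp HB0 HB; assert (H2 := rpow_ge0 2 p).
assert (Hin : forall F, in_lp 2 (emb d (trunc N F))) by (intros; eapply in_lp_supp, supp_emb).
assert (Hpart : forall s, sum_f_R0 (fun i => rpow (Cmod (T (emb d (trunc N (half s d f))) (signed e i))) p) N
   <= rpow 2 p * (2 * B) * sum_f_R0 (lp_terms p f) N).
{ intros s; eapply Rle_trans; [now apply side_part_bound with (B := B)|].
  apply Rmult_le_compat_l; [apply Rmult_le_pos; lra|].
  eapply Rle_trans; [|apply (sum_side_le (fun n => rpow (Cmod (f n)) p) d N); intros; apply rpow_ge0].
  apply sum_le; intros j _; apply rpow_le; [exact Hp | apply half_le]. }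
apply Rle_trans with (rpow 2 p *
   (sum_f_R0 (fun i => rpow (Cmod (T (emb d (trunc N (half true d f))) (signed e i))) p) N
    + sum_f_R0 (fun i => rpow (Cmod (T (emb d (trunc N (half false d f))) (signed e i))) p) N)).
- rewrite <- sum_plus, <- sum_scal; apply sum_le; intros i _.
  destruct HT as [Hadd Hscal]; unfold side; rewrite Hadd, Hscal; auto.
  + eapply Rle_trans; [apply rpow_le; [exact Hp | apply Cmod_triangle]|].
    rewrite Cmod_mult, Cmod_Ci, Rmult_1_l; apply rpow_add_le; auto using Cmod_ge_0.
  + apply (in_lp_supp _ _ N); intros m Hm; rewrite (supp_emb _ _ _ m Hm); ring.
- pose proof (Hpart true); pose proof (Hpart false).
  rewrite Rmult_assoc; apply Rmult_le_compat_l; lra.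
Qed.

(** Partial sums are bounded because [T f] is so far known to lie in l^2 only; for p < 2 membership
    in l^p is itself a consequence. *)
Lemma finite_support_bound T K C0 p : lp_bounded_op 2 T -> has_kernel T K -> kernel_size K C0 ->
  kernel_smooth K C0 -> 1 < p ->
  exists B, 0 <= B /\ forall f M n, supp_in f M ->
    sum_n (lp_terms p (T f)) n <= B * Series (lp_terms p f).
Proof.
intros HT HK Hsz Hsm Hp.
destruct (block_lp T K C0 p HT HK Hsz Hsm Hp) as (B & HB & Hblock).
assert (H2 := rpow_ge0 2 p).
set (B1 := rpow 2 p * (rpow 2 p * (4 * B))).
assert (HB1 : 0 <= B1) by (repeat apply Rmult_le_pos; lra).
exists (4 * (rpow 2 p * B1)); split; [repeat apply Rmult_le_pos; lra|].
(* The section must hold the support of [f] and all outputs of the first n + 1 pairs, which reach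
   down to -n-1. *)
intros f M n HfM; set (N := Nat.max M (S n)).
assert (Hf : supp_in f N) by (intros m Hm; apply HfM; lia).
assert (Hside : forall d, in_lp 2 (side d f N)).
{ intros d; apply (in_lp_supp _ _ N); intros m Hm; unfold side.
  rewrite !(supp_emb _ _ _ m Hm); ring. }
assert (Hsig : forall e, sum_f_R0 (fun i => rpow (Cmod (T f (signed e i))) p) (S n)
    <= rpow 2 p * (2 * B1) * Series (lp_terms p f)).
{ intros e; eapply Rle_trans; [apply (sum_mono _ _ N); [intros; apply rpow_ge0 | lia]|].
  apply Rle_trans with (rpow 2 p *
   (sum_f_R0 (fun i => rpow (Cmod (T (side true f N) (signed e i))) p) N
    + sum_f_R0 (fun i => rpow (Cmod (T (side false f N) (signed e i))) p) N)).
  - rewrite <- sum_plus, <- sum_scal; apply sum_le; intros i _.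
    rewrite (supp_split f N Hf) at 1; rewrite (proj1 (proj1 HT)) by auto.
    eapply Rle_trans; [apply rpow_le; [lra | apply Cmod_triangle]|].
    apply rpow_add_le; auto using Cmod_ge_0; lra.
  - assert (Hle : forall d, sum_f_R0 (fun i => rpow (Cmod (T (side d f N) (signed e i))) p) N
        <= B1 * Series (lp_terms p f)).
    { intros d; eapply Rle_trans; [apply (side_bound T p B); [apply HT | lra | exact HB | exact Hblock]|].
      apply Rmult_le_compat_l; [exact HB1|]; rewrite <- sum_n_Reals.
      apply sum_n_le_Series; [apply lp_terms_ge0 | now apply in_lp_supp with M]. }
    pose proof (Hle true); pose proof (Hle false).
    rewrite Rmult_assoc; apply Rmult_le_compat_l; lra. }
rewrite sum_n_Reals.
eapply Rle_trans;
  [apply (sum_le_sides (fun m => rpow (Cmod (T f m)) p)); intros; apply rpow_ge0|].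
pose proof (Hsig true); pose proof (Hsig false); lra.
Qed.

(** * Extension by truncation *)

(** At 0 continuity rests on the convention [rpow 0 p = 0]; at positive points the function is
    locally [Rpower]. *)
Lemma continuous_rpow (p x : R) : 0 < p -> continuous (fun y => rpow y p) x.
Proof.
intros Hp; destruct (Rle_dec x 0) as [Hx|Hx].
- apply filterlim_locally; intros eps.
  assert (Hd : 0 < rpow eps (/ p)) by (apply rpow_gt0, cond_pos).
  exists (mkposreal _ Hd); intros y Hy.
  change (Rabs (y - x) < rpow eps (/ p)) in Hy; change (Rabs (rpow y p - rpow x p) < eps).
  replace (rpow x p) with 0 by (unfold rpow; destruct (Rle_dec x 0); tauto).
  rewrite Rminus_0_r, Rabs_pos_eq by apply rpow_ge0.
  destruct (Rle_dec y 0) as [Hy0|Hy0].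
  + replace (rpow y p) with 0 by (unfold rpow; destruct (Rle_dec y 0); tauto); apply cond_pos.
  + rewrite <- (rpow_inv_r eps p) by (try apply Rlt_le, cond_pos; lra).
    rewrite (rpow_Rpower y), (rpow_Rpower (rpow eps (/ p))) by lra.
    apply Rlt_Rpower_l; [lra|]; split; [lra|].
    rewrite Rabs_pos_eq in Hy by lra; lra.
- assert (Hx' : 0 < x) by lra.
  apply continuous_ext_loc with (fun y => Rpower y p).
  + exists (mkposreal x Hx'); intros y Hy; change (Rabs (y - x) < x) in Hy.
    apply Rabs_def2 in Hy; symmetry; apply rpow_Rpower; lra.
  + apply continuity_pt_filterlim, derivable_continuous_pt.
    eexists; apply derivable_pt_lim_power; exact Hx'.
Qed.

Lemma is_lim_seq_rpow (u : nat -> R) (l p : R) : 0 < p -> is_lim_seq u l ->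
  is_lim_seq (fun k => rpow (u k) p) (rpow l p).
Proof.
intros Hp; apply (is_lim_seq_continuous (fun y => rpow y p)).
now apply continuity_pt_filterlim, continuous_rpow.
Qed.

Lemma is_lim_seq_root (gap : nat -> R) (p B : R) : 0 < p -> is_lim_seq gap 0 ->
  is_lim_seq (fun M => rpow (B * gap M) (/ p)) 0.
Proof.
intros Hp Hgap; rewrite <- (rpow_0 (/ p)).
apply is_lim_seq_rpow; [now apply Rinv_0_lt_compat|].
rewrite <- (Rmult_0_r B); now apply (is_lim_seq_scal_l gap B 0).
Qed.

Lemma Rabs_le_root (x y p : R) : 0 < p -> rpow (Rabs x) p <= y -> Rabs x <= rpow y (/ p).
Proof.
intros Hp Hxy; rewrite <- (rpow_inv (Rabs x) p) by (try apply Rabs_pos; exact Hp).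
apply rpow_le; [left; now apply Rinv_0_lt_compat | exact Hxy].
Qed.

Lemma is_lim_seq_of_gap (u gap : nat -> R) (l p B : R) : 0 < p -> is_lim_seq gap 0 ->
  (forall M, rpow (Rabs (u M - l)) p <= B * gap M) -> is_lim_seq u l.
Proof.
intros Hp Hgap Hu.
apply is_lim_seq_ext with (fun M => (u M - l) + l); [intros; ring|].
replace (Finite l) with (Finite (0 + l)) by (f_equal; ring); apply is_lim_seq_plus'; [|apply is_lim_seq_const].
apply is_lim_seq_abs_0.
apply is_lim_seq_le_le with (fun _ => 0) (fun M => rpow (B * gap M) (/ p)).
- intros M; split; [apply Rabs_pos | now apply Rabs_le_root].
- apply is_lim_seq_const.
- now apply is_lim_seq_root.
Qed.

Lemma ex_lim_seq_of_gap (u gap : nat -> R) (p B : R) : 0 < p -> is_lim_seq gap 0 ->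
  (forall M M', (M <= M')%nat -> rpow (Rabs (u M' - u M)) p <= B * gap M) ->
  ex_finite_lim_seq u.
Proof.
intros Hp Hgap Hu; apply ex_lim_seq_cauchy_corr; intros eps.
destruct (proj2 (is_lim_seq_spec _ _) (is_lim_seq_root gap p B Hp Hgap) eps) as [N HN].
assert (H : forall n m, (N <= n)%nat -> (n <= m)%nat -> Rabs (u m - u n) < eps).
{ intros n m Hn Hnm; specialize (HN n Hn).
  rewrite Rminus_0_r, Rabs_pos_eq in HN by apply rpow_ge0.
  eapply Rle_lt_trans; [|exact HN]; apply Rabs_le_root; auto. }
exists N; intros n m Hn Hm; destruct (Nat.le_gt_cases n m) as [Hnm|Hnm].
- rewrite Rabs_minus_sym; now apply H.
- apply H; lia.
Qed.

(* The window [-M-1, M] is the set of indices occurring in [lp_terms p f k] for [k <= M]. *)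
Definition zcut (M : nat) (f : Z -> C) (m : Z) : C :=
  if (Z.leb (- Z.of_nat M - 1) m && Z.leb m (Z.of_nat M))%bool then f m else RtoC 0.

(** The tail is written with the scalar -1 so that the two clauses of [lp_linear] apply directly. *)
Definition rest (M : nat) (f : Z -> C) (m : Z) : C :=
  Cplus (f m) (Cmult (RtoC (-1)) (zcut M f m)).

Lemma zcut_in M f m : (- Z.of_nat M - 1 <= m <= Z.of_nat M)%Z -> zcut M f m = f m.
Proof.
intros H; unfold zcut; destruct (Z.leb_spec (- Z.of_nat M - 1) m), (Z.leb_spec m (Z.of_nat M));
  try lia; reflexivity.
Qed.

Lemma zcut_out M f m : ~ (- Z.of_nat M - 1 <= m <= Z.of_nat M)%Z -> zcut M f m = 0%C.
Proof.
intros H; unfold zcut; destruct (Z.leb_spec (- Z.of_nat M - 1) m), (Z.leb_spec m (Z.of_nat M));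
  try lia; reflexivity.
Qed.

Lemma supp_zcut M f : supp_in (zcut M f) (S M).
Proof. intros m Hm; apply zcut_out; lia. Qed.

Lemma zcut_zcut M M' f : (M <= M')%nat -> zcut M (zcut M' f) = zcut M f.
Proof.
intros HM; apply functional_extensionality; intros m.
destruct (Z_le_dec (- Z.of_nat M - 1) m), (Z_le_dec m (Z.of_nat M));
  [rewrite !zcut_in by lia | rewrite !zcut_out by lia ..]; reflexivity.
Qed.

Lemma lp_terms_zcut p M f k : lp_terms p (zcut M f) k = trunc M (lp_terms p f) k.
Proof.
unfold trunc, lp_terms; destruct (Nat.leb_spec k M).
- now rewrite !zcut_in by lia.
- rewrite !zcut_out, Cmod_0, rpow_0 by lia; ring.
Qed.

Lemma lp_terms_rest p M f k :
  lp_terms p (rest M f) k = lp_terms p f k - trunc M (lp_terms p f) k.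
Proof.
unfold trunc, lp_terms, rest; destruct (Nat.leb_spec k M).
- rewrite !zcut_in by lia.
  replace (Cplus (f (Z.of_nat k)) (Cmult (RtoC (-1)) (f (Z.of_nat k)))) with (RtoC 0) by ring.
  replace (Cplus (f (- Z.of_nat k - 1)%Z) (Cmult (RtoC (-1)) (f (- Z.of_nat k - 1)%Z)))
    with (RtoC 0) by ring.
  rewrite Cmod_0, rpow_0; ring.
- rewrite !zcut_out, !Cmult_0_r, !Cplus_0_r by lia; ring.
Qed.

Definition gap (p : R) (f : Z -> C) (M : nat) : R :=
  Series (lp_terms p f) - sum_n (lp_terms p f) M.

Lemma is_lim_gap p f : in_lp p f -> is_lim_seq (gap p f) 0.
Proof.
intros Hf; rewrite <- (Rminus_diag (Series (lp_terms p f))); apply is_lim_seq_minus'.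
- apply is_lim_seq_const.
- now apply is_lim_sum_n_Series.
Qed.

Lemma Series_rest_le p M f : in_lp p f ->
  in_lp p (rest M f) /\ Series (lp_terms p (rest M f)) <= gap p f M.
Proof.
intros Hf; apply ex_series_bounded; [apply lp_terms_ge0|]; intros n.
set (L := Nat.max n M).
apply Rle_trans with (sum_n (lp_terms p (rest M f)) L).
- rewrite !sum_n_Reals; apply sum_mono; [apply lp_terms_ge0 | lia].
- unfold gap; rewrite (sum_n_Reals _ L).
  rewrite (sum_eq _ (fun k => lp_terms p f k - trunc M (lp_terms p f) k))
    by (intros; apply lp_terms_rest).
  rewrite minus_sum, sum_trunc by lia; rewrite <- !sum_n_Reals.
  assert (H := sum_n_le_Series (lp_terms p f) L (lp_terms_ge0 p f) Hf); lra.
Qed.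

Lemma Series_zcut_le p M f : in_lp p f ->
  Series (lp_terms p (zcut M f)) <= Series (lp_terms p f).
Proof.
intros Hf; apply Series_le; [|exact Hf]; intros k; split; [apply lp_terms_ge0|].
rewrite lp_terms_zcut; unfold trunc.
pose proof (lp_terms_ge0 p f k); destruct (k <=? M)%nat; lra.
Qed.

(** Makes the Cauchy estimate uniform in [M']: the tail of a truncation is dominated by that of
    [f]. *)
Lemma gap_zcut_le p M M' f : (M <= M')%nat -> in_lp p f -> gap p (zcut M' f) M <= gap p f M.
Proof.
intros HM Hf; unfold gap.
replace (sum_n (lp_terms p (zcut M' f)) M) with (sum_n (lp_terms p f) M).
- pose proof (Series_zcut_le p M' f Hf); lra.
- rewrite !sum_n_Reals; apply sum_eq; intros k Hk; rewrite lp_terms_zcut; unfold trunc.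
  now rewrite (proj2 (Nat.leb_le k M')) by lia.
Qed.

Lemma part_rest T r M f n : lp_linear 2 T -> in_lp 2 f ->
  part r (T (rest M f) n) = part r (T f n) - part r (T (zcut M f) n).
Proof.
intros [Hadd Hscal] Hf.
assert (Hcut : in_lp 2 (zcut M f)) by (eapply in_lp_supp, supp_zcut).
unfold rest; rewrite Hadd, Hscal, part_plus, part_scal; trivial; [ring|].
apply (in_lp_supp _ _ (S M)); intros m Hm; rewrite (supp_zcut M f m Hm); ring.
Qed.

(** [Lim_seq] and [real] are total, so this is defined for every [f]; the limits are genuine on l^p.
    The formula does not mention [p]. *)
Definition extension (T : (Z -> C) -> Z -> C) (f : Z -> C) (n : Z) : C :=
  (real (Lim_seq (fun M => part true (T (zcut M f) n))),
   real (Lim_seq (fun M => part false (T (zcut M f) n)))).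

Lemma extension_unique T f n z :
  (forall r, is_lim_seq (fun M => part r (T (zcut M f) n)) (part r z)) -> extension T f n = z.
Proof.
intros H; unfold extension.
rewrite (is_lim_seq_unique _ _ (H true)), (is_lim_seq_unique _ _ (H false)).
now destruct z.
Qed.

(** The difference of two truncations is [rest M (zcut M' f)], again finitely supported; one
    coordinate of its image is bounded by the whole p-sum, so the coordinates form a Cauchy
    sequence. *)
Lemma extension_lim T p B f n r : lp_linear 2 T -> 0 < p -> in_lp p f -> 0 <= B ->
  (forall f M n, supp_in f M -> sum_n (lp_terms p (T f)) n <= B * Series (lp_terms p f)) ->
  is_lim_seq (fun M => part r (T (zcut M f) n)) (part r (extension T f n)).
Proof.
intros HT Hp Hf HB0 HB.
enough (Hex : ex_finite_lim_seq (fun M => part r (T (zcut M f) n))).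
{ apply Lim_seq_correct' in Hex; destruct r; exact Hex. }
apply ex_lim_seq_of_gap with (gap p f) p B; [exact Hp | now apply is_lim_gap|].
intros M M' HM; set (g := zcut M' f).
assert (Hg : supp_in g (S M')) by apply supp_zcut.
rewrite <- (zcut_zcut M M' f HM); fold g.
rewrite <- part_rest by (trivial; now apply in_lp_supp with (S M')).
eapply Rle_trans; [apply rpow_le; [lra | apply part_le_Cmod]|].
eapply Rle_trans; [apply (point_le_sum_lp_terms p (T (rest M g)))|].
eapply Rle_trans; [apply (HB _ (S M'))|].
- intros m Hm; unfold rest; rewrite zcut_out, Hg by lia; ring.
- apply Rmult_le_compat_l; [exact HB0|].
  eapply Rle_trans; [apply Series_rest_le; now apply in_lp_supp with (S M')|].
  now apply gap_zcut_le.
Qed.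

(** Truncations converge to [f] in l^2 and [T] is continuous there, so coordinates converge to those
    of [T f]. *)
Lemma extension_eq T f n : lp_bounded_op 2 T -> in_lp 2 f -> extension T f n = T f n.
Proof.
intros HT Hf; destruct (bounded_op_Series 2 T ltac:(lra) HT) as (B & HB & HTB).
apply extension_unique; intros r.
apply is_lim_seq_of_gap with (gap 2 f) 2 B; [lra | now apply is_lim_gap|]; intros M.
destruct (Series_rest_le 2 M f Hf) as [Hr Hrle], (HTB _ Hr) as [HTr HTrle].
rewrite Rabs_minus_sym, <- part_rest by (trivial; apply HT).
eapply Rle_trans; [apply rpow_le; [lra | apply part_le_Cmod]|].
eapply Rle_trans; [apply (point_le_sum_lp_terms 2 (T (rest M f)))|].
eapply Rle_trans; [apply sum_n_le_Series; [apply lp_terms_ge0 | exact HTr]|].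
eapply Rle_trans; [exact HTrle | now apply Rmult_le_compat_l].
Qed.

Lemma is_lim_seq_Cmod (u : nat -> C) (z : C) :
  (forall r, is_lim_seq (fun M => part r (u M)) (part r z)) ->
  is_lim_seq (fun M => Cmod (u M)) (Cmod z).
Proof.
intros H; unfold Cmod.
apply (is_lim_seq_continuous sqrt (fun M => fst (u M) ^ 2 + snd (u M) ^ 2)).
- apply continuity_pt_filterlim, continuous_sqrt.
- simpl; apply is_lim_seq_plus'; repeat apply is_lim_seq_mult';
    try apply is_lim_seq_const; [apply (H true) .. | apply (H false) | apply (H false)].
Qed.

(** Fatou's argument: for fixed [n] the bound on the partial sum passes to the pointwise limit, and
    the result is uniform in [n]. *)
Lemma extension_bounded T p B f : lp_linear 2 T -> 0 < p -> in_lp p f -> 0 <= B ->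
  (forall f M n, supp_in f M -> sum_n (lp_terms p (T f)) n <= B * Series (lp_terms p f)) ->
  in_lp p (extension T f) /\ Series (lp_terms p (extension T f)) <= B * Series (lp_terms p f).
Proof.
intros HT Hp Hf HB0 HB; apply ex_series_bounded; [apply lp_terms_ge0|]; intros n.
assert (Hterm : forall m, is_lim_seq (fun M => rpow (Cmod (T (zcut M f) m)) p)
                                     (rpow (Cmod (extension T f m)) p)).
{ intros m; apply is_lim_seq_rpow; [exact Hp|]; apply is_lim_seq_Cmod; intros r.
  now apply extension_lim with p B. }
assert (Hsum : is_lim_seq (fun M => sum_n (lp_terms p (T (zcut M f))) n)
                          (sum_n (lp_terms p (extension T f)) n)).
{ induction n as [|n IH].
  - rewrite sum_O; apply is_lim_seq_ext with (fun M => lp_terms p (T (zcut M f)) 0);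
      [intros M; symmetry; apply (sum_O (lp_terms p (T (zcut M f))))|].
    now apply is_lim_seq_plus'.
  - rewrite sum_Sn; apply is_lim_seq_ext with
      (fun M => sum_n (lp_terms p (T (zcut M f))) n + lp_terms p (T (zcut M f)) (S n));
      [intros M; symmetry; apply (sum_Sn (lp_terms p (T (zcut M f))))|].
    apply is_lim_seq_plus'; [exact IH | now apply is_lim_seq_plus']. }
refine (is_lim_seq_le _ (fun _ => B * Series (lp_terms p f)) _ _ _ Hsum (is_lim_seq_const _)).
intros M; eapply Rle_trans; [apply (HB _ (S M)), supp_zcut|].
apply Rmult_le_compat_l; [exact HB0 | now apply Series_zcut_le].
Qed.

Lemma zcut_plus M f g : zcut M (fun k => Cplus (f k) (g k)) = fun k => Cplus (zcut M f k) (zcut M g k).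
Proof.
apply functional_extensionality; intros k; unfold zcut; destruct (_ && _); [reflexivity | ring].
Qed.

Lemma zcut_scal M c f : zcut M (fun k => Cmult c (f k)) = fun k => Cmult c (zcut M f k).
Proof.
apply functional_extensionality; intros k; unfold zcut; destruct (_ && _); [reflexivity | ring].
Qed.

Lemma extension_linear T p B : lp_linear 2 T -> 0 < p -> 0 <= B ->
  (forall f M n, supp_in f M -> sum_n (lp_terms p (T f)) n <= B * Series (lp_terms p f)) ->
  lp_linear p (extension T).
Proof.
intros HT Hp HB0 HB.
assert (Hin : forall M f, in_lp 2 (zcut M f)) by (intros; eapply in_lp_supp, supp_zcut).
split.
- intros f g Hf Hg n; apply extension_unique; intros r; rewrite part_plus.
  apply is_lim_seq_ext with
    (fun M => part r (T (zcut M f) n) + part r (T (zcut M g) n)).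
  + intros M; rewrite zcut_plus, (proj1 HT), part_plus; auto.
  + apply is_lim_seq_plus'; now apply extension_lim with p B.
- intros c f Hf n; apply extension_unique; intros r.
  assert (Hlim : forall r, is_lim_seq (fun M => part r (T (zcut M f) n)) (part r (extension T f n)))
    by (intros; now apply extension_lim with p B).
  apply is_lim_seq_ext with (fun M => part r (Cmult c (T (zcut M f) n))).
  { intros M; rewrite zcut_scal, (proj2 HT); auto. }
  (* A complex scalar mixes real and imaginary parts, so both limits enter for either value of
     [r]. *)
  pose proof (Hlim true) as H1; pose proof (Hlim false) as H2.
  destruct r; unfold part, Re, Im in *; simpl.
  + apply is_lim_seq_minus'; apply is_lim_seq_mult'; trivial; apply is_lim_seq_const.
  + apply is_lim_seq_plus'; apply is_lim_seq_mult'; trivial; apply is_lim_seq_const.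
Qed.

Theorem theorem3p3 (T : (Z -> C) -> (Z -> C)) (K : Z -> Z -> C) (C0 : R) :
  (* T is a bounded linear operator on l^2(Z) *)
  lp_bounded_op 2 T ->
  (* kernel representation off the diagonals |n| = |m| *)
  (forall (f : Z -> C) (N : nat), supp_in f N ->
     forall n : Z, f n = 0%C -> f (- n)%Z = 0%C ->
       T f n = zsum (fun m => Cmult (K n m) (f m)) N) ->
  (* (i) size condition *)
  (forall n m : Z, Z.abs n <> Z.abs m ->
     Cmod (K n m) <= C0 / IZR (Z.abs (n - m))) ->
  (* (ii) smoothness condition *)
  (forall m n l : Z,
     IZR (Z.abs (Z.abs m - Z.abs n)) > 2 * IZR (Z.abs (m - l)) ->
     IZR (Z.abs n) / 2 <= IZR (Z.abs m) <= 3 * IZR (Z.abs n) / 2 ->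
     IZR (Z.abs n) / 2 <= IZR (Z.abs l) <= 3 * IZR (Z.abs n) / 2 ->
     Cmod (Cminus (K n m) (K n l)) + Cmod (Cminus (K m n) (K l n))
       <= C0 * IZR (Z.abs (m - l)) / (IZR (Z.abs m - Z.abs n)) ^ 2) ->
  (* conclusion: T extends to a bounded operator on l^p(Z), 1 < p < oo *)
  forall p : R, 1 < p ->
    exists S : (Z -> C) -> (Z -> C),
      lp_bounded_op p S /\
      (forall f, in_lp 2 f -> in_lp p f -> forall n, S f n = T f n).
Proof.
intros HT HK Hsz Hsm p Hp.
destruct (finite_support_bound T K C0 p HT HK Hsz Hsm Hp) as (B & HB & HTB).
assert (Hlin : lp_linear 2 T) by apply HT.
exists (extension T); split; [split|].
- apply extension_linear with B; trivial; lra.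
(* [B] bounds p-th power sums; its p-th root bounds the norm. *)
- exists (rpow B (/ p)); intros f Hf.
  destruct (extension_bounded T p B f) as [Hin Hle]; trivial; [lra|].
  split; [exact Hin|]; apply lp_norm_le_of_Series; trivial; [lra|].
  apply Rle_trans with (sum_n (lp_terms p f) 0).
  + rewrite sum_O; apply lp_terms_ge0.
  + apply sum_n_le_Series; [apply lp_terms_ge0 | exact Hf].
- intros f Hf2 _ n; now apply extension_eq.
Qed.
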